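(* Let $I$ be a location-scale family of continuous direct probability distributions for a scalar random variable, with location parameter $\Theta_1$ (realization $\mu\in\mathbb{R}$), scale parameter $\Theta_2$ (realization $\sigma\in\mathbb{R}^+$) and $\mathbf{\Theta}=(\Theta_1,\Theta_2)$. Then the consistency factors $\zeta_{I,\Theta_1|\sigma}(\mu,\sigma)$ (inference about $\mu$ given $\sigma$), $\zeta_{I,\Theta_2|\mu}(\mu,\sigma)$ (inference about $\sigma$ given $\mu$) and $\zeta_{I,\mathbf{\Theta}}(\mu,\sigma)$ (joint inference about $(\mu,\sigma)$) are $$\zeta_{I,\Theta_1|\sigma}(\mu,\sigma)=1,\qquad \zeta_{I,\Theta_2|\mu}(\mu,\sigma)=\zeta_{I,\mathbf{\Theta}}(\mu,\sigma)=\sigma^{-1},$$ each being understood up to the arbitrary multiplier (described in the context) up to which consistency factors are defined.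
   Context: Location-scale family: the cdf's are $F_I(x|\mu,\sigma)=\Phi\left(\frac{x-\mu}{\sigma}\right)$ with $(\mu,\sigma)\in\mathbb{R}\times\mathbb{R}^+$; for continuous distributions the pdf's are $f_I(x|\mu,\sigma)=\frac1\sigma\phi\left(\frac{x-\mu}{\sigma}\right)$ with $\phi=\Phi'$. The random variables $X_1,X_2$ are independent with identical distribution from $I$: $f_I(x_1,x_2|\mu,\sigma)=f_I(x_1|\mu,\sigma)f_I(x_2|\mu,\sigma)$. Direct and inverse distributions. The pdf of a member of a parametric family $I$ with parameter value $\boldsymbol{\theta}$ is written as a conditional (direct) pdf $f_I(\mathbf{x}|\boldsymbol{\theta})$. An inverse probability distribution is a probability distribution for the parameter given a realization $\mathbf{x}$ (and possibly given the remaining parameter components): for some of the $\mathbf{x}$ with $\int f_I(\mathbf{x}|\boldsymbol{\theta})\,d\boldsymbol{\theta}>0$ there is a probability space $(\Omega_{\mathbf{x}},\Sigma_{\mathbf{x}},P)$ on which $(\mathbf{\Theta},\mathbf{X})$, taking values in $V_{\mathbf{\Theta}}\times\{\mathbf{x}\}$, is measurable; the resulting pdf is $f_I(\boldsymbol{\theta}|\mathbf{x})$; likewise $f_I(\boldsymbol{\theta}_1|\boldsymbol{\theta}_2,\mathbf{x})$ with $\boldsymbol{\theta}_2,\mathbf{x}$ fixed. No unconditional pdf for parameters is assumed to exist. Inverse probability distributions are presumed to exist and to obey the following. Rules. (1) Transformation: for differentiable invertible changes $\mathbf{\Lambda}=\bar{\mathbf{s}}\circ\mathbf{\Theta}$,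 $\mathbf{Y}=\mathbf{s}\circ\mathbf{X}$ with non-vanishing Jacobians, leading to the (isomorphic) family $I'$, $f_{I'}(\boldsymbol{\lambda}|\mathbf{y})=f_I(\bar{\mathbf{s}}^{-1}(\boldsymbol{\lambda})|\mathbf{s}^{-1}(\mathbf{y}))\,|\partial_{\boldsymbol{\lambda}}\bar{\mathbf{s}}^{-1}(\boldsymbol{\lambda})|$, and similarly for one parameter component given the other when components are transformed separately. (2) Product rule: $f_I(\boldsymbol{\theta}_1|\boldsymbol{\theta}_2,\mathbf{x})=f_I(\boldsymbol{\theta}_1,\boldsymbol{\theta}_2|\mathbf{x})/f_I(\boldsymbol{\theta}_2|\mathbf{x})$ wherever $f_I(\boldsymbol{\theta}_2|\mathbf{x})=\int f_I(\boldsymbol{\theta}_1,\boldsymbol{\theta}_2|\mathbf{x})\,d\boldsymbol{\theta}_1>0$. (3) Bayes' Theorem: $f_I(\boldsymbol{\theta}_1|\boldsymbol{\theta}_2,x_1,x_2)=\dfrac{f_I(\boldsymbol{\theta}_1|\boldsymbol{\theta}_2,x_1)\,f_I(x_2|\boldsymbol{\theta}_1,\boldsymbol{\theta}_2)}{f_I(x_2|\boldsymbol{\theta}_2,x_1)}$, and the same with indices $1,2$ of $x$ interchanged (all densities involved existing and the marginals being positive). Consistency factors. These are the functions $\zeta$, independent of the data, in $$f_I(\mu|\sigma,x)=\frac{\zeta_{I,\Theta_1|\sigma}(\mu,\sigma)}{\eta_{I,\Theta_1|\sigma}(x,\sigma)}f_I(x|\mu,\sigma),\quad f_I(\sigma|\mu,x)=\frac{\zeta_{I,\Theta_2|\mu}(\mu,\sigma)}{\eta_{I,\Theta_2|\mu}(x,\mu)}f_I(x|\mu,\sigma),$$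 $$f_I(\mu,\sigma|x_1,x_2)=\frac{\zeta_{I,\mathbf{\Theta}}(\mu,\sigma)}{\eta_{I,\mathbf{\Theta}}(x_1,x_2)}f_I(x_1,x_2|\mu,\sigma),$$ where the normalization factors $\eta$ are fixed by requiring each inverse pdf to integrate to $1$. The formulas apply to those data for which the inverse distribution exists (the inverse distribution for $\Theta_2$ given $\mu$ and $x=\mu$ does not exist). A consistency factor is determined only up to a multiplier that cancels against $\eta$: $\zeta_{I,\Theta_1|\sigma}$ up to a factor not depending on $\mu$, $\zeta_{I,\Theta_2|\mu}$ up to a factor not depending on $\sigma$, and $\zeta_{I,\mathbf{\Theta}}$ up to a factor not depending on $(\mu,\sigma)$. Each consistency factor has constant sign on its parameter space. Under transformations as in (1) consistency factors transform, up to such multipliers, as $\zeta_{I',\mathbf{\Lambda}}(\boldsymbol{\lambda})=\chi\,\zeta_{I,\mathbf{\Theta}}[\bar{\mathbf{s}}^{-1}(\boldsymbol{\lambda})]\,|\partial_{\boldsymbol{\lambda}}\bar{\mathbf{s}}^{-1}(\boldsymbol{\lambda})|$. If the family is invariant under a group of transformations $\mathbf{g}_a$ of the sample with induced parameter transformations $\bar{\mathbf{g}}_a$ (i.e. if $\mathbf{X}$ has parameter $\boldsymbol{\theta}$ then $\mathbf{g}_a\circ\mathbf{X}$ has the member of the same family $I$ with parameter $\bar{\mathbf{g}}_a(\boldsymbol{\theta})$), then the transformed family $I'$ is $I$ itself and $\zeta_{I',\cdot}$ is the same function as $\zeta_{I,\cdot}$, with a multiplier $\chi$ that may depend on $a$.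 In particular a location-scale family is invariant under $x\mapsto a_2x+a_1$ with $(\mu,\sigma)\mapsto(a_2\mu+a_1,a_2\sigma)$, $(a_1,a_2)\in\mathbb{R}\times\mathbb{R}^+$, and for $\zeta_{I,\Theta_1|\sigma}$ this reads $\zeta_{I,\Theta_1|\sigma}(\mu,\sigma)=\frac{\chi_{I,\Theta_1|\sigma}(a_1,a_2)}{a_2}\,\zeta_{I,\Theta_1|\sigma}\left(\frac{\mu-a_1}{a_2},\frac{\sigma}{a_2}\right)$. *)

(* Defs.v *)
From HB Require Import structures.
From mathcomp Require Import all_boot all_order all_algebra.
From mathcomp Require Import all_classical all_reals all_analysis.

Set Implicit Arguments.
Unset Strict Implicit.
Unset Printing Implicit Defensive.

Import Order.TTheory GRing.Theory Num.Theory numFieldNormedType.Exports.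

Local Open Scope classical_set_scope.
Local Open Scope ring_scope.

Definition leb1 (R : realType) : {measure set (measurableTypeR R) -> \bar R} :=
  @lebesgue_measure R.

Definition leb2 (R : realType) :
    {measure set (measurableTypeR R * measurableTypeR R) -> \bar R} :=
  (@lebesgue_measure R \x @lebesgue_measure R)%E.

Definition is_density (R : realType) d (X : measurableType d)
    (m : {measure set X -> \bar R}) (D : set X) (f : X -> R) : Prop :=
  [/\ measurable_fun D f, (forall x, D x -> 0 <= f x) &
      (\int[m]_(x in D) (f x)%:E = 1)%E].

(* [dens I theta x] is the direct pdf f_I(x|theta); it is relevant only for
   [theta] in the parameter space [params I]. *)
Record parametric_family (R X P : Type) := Family {
  params : set P;
  dens : P -> X -> R
}.

Definition is_direct (R : realType) d (X : measurableType d)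
    (P : topologicalType) (m : {measure set X -> \bar R})
    (I : parametric_family R X P) : Prop :=
  open (params I) /\
  forall theta, params I theta -> is_density m setT (dens I theta).

(* Inference about one component given the other is inference in the
   one-parameter family in which the given component is held fixed. *)
Definition fix1 (R X P1 P2 : Type)
    (I : parametric_family R X (P1 * P2)) (t1 : P1) :
    parametric_family R X P2 :=
  Family [set t2 | params I (t1, t2)] (fun t2 => dens I (t1, t2)).

Definition fix2 (R X P1 P2 : Type)
    (I : parametric_family R X (P1 * P2)) (t2 : P2) :
    parametric_family R X P1 :=
  Family [set t1 | params I (t1, t2)] (fun t1 => dens I (t1, t2)).

Definition iid (R : realType) (P : Type) (I : parametric_family R R P) :
    parametric_family R (R * R) P :=
  Family (params I) (fun theta x => dens I theta x.1 * dens I theta x.2).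

Definition regular1 (R : realType) (D : set R) (s : R -> R) : Prop :=
  set_inj D s /\ forall x, D x -> derivable s x 1 /\ derive1 s x != 0.

Definition jacobian2 (R : realType) (s : R * R -> R * R) (x : R * R) : R :=
  let u : R * R := 'd s x (1, 0) in
  let v : R * R := 'd s x (0, 1) in
  u.1 * v.2 - u.2 * v.1.

Definition regular2 (R : realType) (D : set (R * R)) (s : R * R -> R * R) :
    Prop :=
  set_inj D s /\ forall x, D x -> differentiable s x /\ jacobian2 s x != 0.

Definition separate (A B C D : Type) (f : A -> C) (g : B -> D) (p : A * B) :
    C * D :=
  (f p.1, g p.2).

Definition regular_separate (R : realType) (D : set (R * R))
    (sb1 sb2 : R -> R) : Prop :=
  regular1 (fst @` D) sb1 /\ regular1 (snd @` D) sb2.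

(* [I'] is the family of Y = s o X with parameter sb o Theta, where [J] is the
   Jacobian determinant of [s].  The change of variable [s] is only required
   to be defined on an open set [U] in which X takes its values almost surely
   (e.g. x <> mu for logarithms and powers of |x - mu|). *)
Definition transformed (R : realType) d (X : measurableType d) (P : Type)
    (m : {measure set X -> \bar R}) (U : set X) (s : X -> X) (J : X -> R)
    (sb : P -> P) (I I' : parametric_family R X P) : Prop :=
  [/\ params I' = sb @` params I,
      (forall theta, params I theta ->
        (\int[m]_(x in U) (dens I theta x)%:E = 1)%E) &
      (forall theta x, params I theta -> U x ->
        dens I theta x = dens I' (sb theta) (s x) * `|J x|)].

Definition transformed1 (R : realType) (P : Type) (U : set R) (s : R -> R)
    (sb : P -> P) (I I' : parametric_family R R P) : Prop :=
  [/\ open U, regular1 U s & transformed (@leb1 R) U s (derive1 s) sb I I'].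

Definition transformed2 (R : realType) (P : Type) (U : set (R * R))
    (s : R * R -> R * R) (sb : P -> P)
    (I I' : parametric_family R (R * R) P) : Prop :=
  [/\ open U, regular2 U s &
      transformed (@leb2 R) U s (jacobian2 s) sb I I'].

(* An inverse distribution for given data need not exist, hence [option].
   With lambda = sb theta, the relation below reads
   f_I'(lambda|y) = f_I(sb^-1 lambda|s^-1 y) |d sb^-1(lambda)|. *)
Definition inverse_transformed (R : realType) (P : Type) (D : set P)
    (sb : P -> P) (J : P -> R) (g g' : option (P -> R)) : Prop :=
  match g, g' with
  | Some f, Some f' =>
      forall theta, D theta -> f theta = f' (sb theta) * `|J theta|
  | None, None => True
  | _, _ => False
  end.

Definition is_inverse_pdf (R : realType) (X : Type) d (P : measurableType d)
    (m : {measure set P -> \bar R}) (I : parametric_family R X P)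
    (x : X) (g : P -> R) : Prop :=
  is_density m (params I) g /\
  (0 < \int[m]_(theta in params I) (dens I theta x)%:E)%E.

(* [zeta] is a consistency factor of [I] for the inverse pdf's [inv] (which
   exist for some data); as every [g] below integrates to 1, [eta x] is the
   normalization of zeta(theta) f_I(x|theta). *)
Definition consistency_factor (R : realType) (X P : Type)
    (I : parametric_family R X P) (inv : X -> option (P -> R))
    (zeta : P -> R) : Prop :=
  [/\ exists x, isSome (inv x),
      (forall theta, params I theta -> 0 < zeta theta) \/
      (forall theta, params I theta -> zeta theta < 0) &
      exists eta : X -> R, forall x g, inv x = Some g ->
        eta x != 0 /\
        forall theta, params I theta ->
          g theta = zeta theta / eta x * dens I theta x].

(* An assignment of inverse pdf's to direct families: [inv11] for a scalar
   parameter given one datum, [inv21] for a scalar parameter given two data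
   and [inv22] for two parameters given two data. *)
Record inverse_assignment (R : realType) := InverseAssignment {
  inv11 : parametric_family R R R -> R -> option (R -> R);
  inv21 : parametric_family R (R * R) R -> R * R -> option (R -> R);
  inv22 : parametric_family R (R * R) (R * R) -> R * R -> option (R * R -> R)
}.

Definition cfactor_given2 (R : realType) (T : inverse_assignment R)
    (I : parametric_family R R (R * R)) (zeta : R * R -> R) : Prop :=
  forall t2, params (fix2 I t2) !=set0 ->
    consistency_factor (fix2 I t2) (inv11 T (fix2 I t2))
      (fun t1 => zeta (t1, t2)).

Definition cfactor_given1 (R : realType) (T : inverse_assignment R)
    (I : parametric_family R R (R * R)) (zeta : R * R -> R) : Prop :=
  forall t1, params (fix1 I t1) !=set0 ->
    consistency_factor (fix1 I t1) (inv11 T (fix1 I t1))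
      (fun t2 => zeta (t1, t2)).

Definition cfactor_joint (R : realType) (T : inverse_assignment R)
    (I : parametric_family R R (R * R)) (zeta : R * R -> R) : Prop :=
  consistency_factor (iid I) (inv22 T (iid I)) zeta.

Definition existence_rule (R : realType) (T : inverse_assignment R) : Prop :=
  [/\ (forall I x g, is_direct (@leb1 R) I -> inv11 T I x = Some g ->
        is_inverse_pdf (@leb1 R) I x g),
      (forall I x g, is_direct (@leb2 R) I -> inv21 T I x = Some g ->
        is_inverse_pdf (@leb1 R) I x g) &
      (forall I x g, is_direct (@leb2 R) I -> inv22 T I x = Some g ->
        is_inverse_pdf (@leb2 R) I x g)].

(* The two components of a vector parameter are transformed separately: a
   change of parameters mixing them alters the meaning of "given theta_2", and
   conditioning on a null event is not invariant under such changes (Borel's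
   paradox). *)
Definition transformation_rule (R : realType) (T : inverse_assignment R) :
    Prop :=
  [/\ (forall (I I' : parametric_family R R R) U s sb,
        is_direct (@leb1 R) I -> is_direct (@leb1 R) I' ->
        regular1 (params I) sb -> transformed1 U s sb I I' ->
        forall x, U x ->
          inverse_transformed (params I) sb (derive1 sb)
            (inv11 T I x) (inv11 T I' (s x))),
      (forall (I I' : parametric_family R (R * R) R) U s sb,
        is_direct (@leb2 R) I -> is_direct (@leb2 R) I' ->
        regular1 (params I) sb -> transformed2 U s sb I I' ->
        forall x, U x ->
          inverse_transformed (params I) sb (derive1 sb)
            (inv21 T I x) (inv21 T I' (s x))) &
      (forall (I I' : parametric_family R (R * R) (R * R)) U s sb1 sb2,
        is_direct (@leb2 R) I -> is_direct (@leb2 R) I' ->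
        regular_separate (params I) sb1 sb2 ->
        transformed2 U s (separate sb1 sb2) I I' ->
        forall x, U x ->
          inverse_transformed (params I) (separate sb1 sb2)
            (fun theta => derive1 sb1 theta.1 * derive1 sb2 theta.2)
            (inv22 T I x) (inv22 T I' (s x)))].

Definition product_rule (R : realType) (T : inverse_assignment R) : Prop :=
  forall (I : parametric_family R (R * R) (R * R)) x g,
    is_direct (@leb2 R) I -> inv22 T I x = Some g ->
    (forall t2,
      let m := (\int[@leb1 R]_(t1 in params (fix2 I t2)) (g (t1, t2))%:E)%E in
      (0 < m < +oo)%E ->
      exists2 h, inv21 T (fix2 I t2) x = Some h &
        forall t1, params (fix2 I t2) t1 -> h t1 = g (t1, t2) / fine m) /\
    (forall t1,
      let m := (\int[@leb1 R]_(t2 in params (fix1 I t1)) (g (t1, t2))%:E)%E in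
      (0 < m < +oo)%E ->
      exists2 h, inv21 T (fix1 I t1) x = Some h &
        forall t2, params (fix1 I t1) t2 -> h t2 = g (t1, t2) / fine m).

(* Stated for the one-parameter family [K] obtained by fixing theta_2:
   [xi] is the first datum used, [xj] the second one, and [m] is
   f_I(xj|theta_2, xi). *)
Definition bayes_rule (R : realType) (T : inverse_assignment R) : Prop :=
  forall (K : parametric_family R R R) x1 x2 h,
    is_direct (@leb1 R) K -> inv21 T (iid K) (x1, x2) = Some h ->
    forall xi xj g, (xi, xj) = (x1, x2) \/ (xi, xj) = (x2, x1) ->
      inv11 T K xi = Some g ->
      let m :=
        (\int[@leb1 R]_(theta in params K) (g theta * dens K theta xj)%:E)%E in
      (0 < m < +oo)%E ->
      forall theta, params K theta ->
        h theta = g theta * dens K theta xj / fine m.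

(* Invariance of a family under transformations of the sample: the consistency
   factor, suitably normalized by a multiplier [k] (depending on the given
   parameter component, and not on the transformation), is the same function
   after the transformation, up to a factor [chi] depending on the
   transformation only:
   zeta(gb theta) |d gb(theta)| = chi zeta(theta). *)
Definition invariance_rule (R : realType) (T : inverse_assignment R) : Prop :=
  [/\ (forall (I : parametric_family R R (R * R)) zeta,
        is_direct (@leb1 R) I -> cfactor_given2 T I zeta ->
        exists2 k : R -> R, (forall theta, params I theta -> k theta.2 != 0) &
        forall U s sb1 sb2, regular_separate (params I) sb1 sb2 ->
          transformed1 U s (separate sb1 sb2) I I ->
          exists chi : R, forall theta, params I theta ->
            k (sb2 theta.2) * zeta (separate sb1 sb2 theta) *
              `|derive1 sb1 theta.1| = chi * (k theta.2 * zeta theta)),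
      (forall (I : parametric_family R R (R * R)) zeta,
        is_direct (@leb1 R) I -> cfactor_given1 T I zeta ->
        exists2 k : R -> R, (forall theta, params I theta -> k theta.1 != 0) &
        forall U s sb1 sb2, regular_separate (params I) sb1 sb2 ->
          transformed1 U s (separate sb1 sb2) I I ->
          exists chi : R, forall theta, params I theta ->
            k (sb1 theta.1) * zeta (separate sb1 sb2 theta) *
              `|derive1 sb2 theta.2| = chi * (k theta.1 * zeta theta)) &
      (forall (I : parametric_family R R (R * R)) zeta,
        is_direct (@leb1 R) I -> cfactor_joint T I zeta ->
        forall U s sb1 sb2, regular_separate (params I) sb1 sb2 ->
          transformed1 U s (separate sb1 sb2) I I ->
          exists chi : R, forall theta, params I theta ->
            zeta (separate sb1 sb2 theta) *
              `|derive1 sb1 theta.1 * derive1 sb2 theta.2| = chi * zeta theta)].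

Definition obeys_inverse_rules (R : realType) (T : inverse_assignment R) :
    Prop :=
  [/\ existence_rule T, transformation_rule T, product_rule T, bayes_rule T &
      invariance_rule T].

(* [Phi] is the cdf of a continuous distribution with pdf [phi]; this covers
   phi = Phi' for everywhere differentiable [Phi]. *)
Definition continuous_cdf (R : realType) (Phi phi : R -> R) : Prop :=
  is_density (@leb1 R) setT phi /\
  forall x, (Phi x)%:E = (\int[@leb1 R]_(t in `]-oo, x]) (phi t)%:E)%E.

Definition is_location_scale (R : realType) (Phi phi : R -> R)
    (I : parametric_family R R (R * R)) : Prop :=
  [/\ continuous_cdf Phi phi,
      params I = [set theta | 0 < theta.2],
      (forall mu sigma x, 0 < sigma ->
        (\int[@leb1 R]_(t in `]-oo, x]) (dens I (mu, sigma) t)%:E)%E =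
        (Phi ((x - mu) / sigma))%:E) &
      (forall mu sigma x, 0 < sigma ->
        dens I (mu, sigma) x = sigma^-1 * phi ((x - mu) / sigma))].

Definition eq_up_to_given2 (R : realType) (D : set (R * R))
    (zeta zeta' : R * R -> R) : Prop :=
  exists c : R -> R, forall theta, D theta ->
    c theta.2 != 0 /\ zeta theta = c theta.2 * zeta' theta.

Definition eq_up_to_given1 (R : realType) (D : set (R * R))
    (zeta zeta' : R * R -> R) : Prop :=
  exists c : R -> R, forall theta, D theta ->
    c theta.1 != 0 /\ zeta theta = c theta.1 * zeta' theta.

Definition eq_up_to_constant (R : realType) (D : set (R * R))
    (zeta zeta' : R * R -> R) : Prop :=
  exists c : R, forall theta, D theta ->
    c != 0 /\ zeta theta = c * zeta' theta.

(* Main.v *)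
Require Import Defs.
From mathcomp Require Import all_boot all_order all_algebra.
From mathcomp Require Import all_classical all_reals all_analysis.
From mathcomp Require Import measurable_realfun ring lra.
Set Implicit Arguments.
Unset Strict Implicit.
Unset Printing Implicit Defensive.
Import Order.TTheory GRing.Theory Num.Theory numFieldNormedType.Exports.
Local Open Scope classical_set_scope.
Local Open Scope ring_scope.

(** The affine group acts on (mu, sigma), and invariance makes each consistency
    factor, suitably normalized and multiplied by the Jacobian of the induced
    parameter change, semi-invariant: an affine map multiplies it by a constant.
    These constants form a homomorphism from the affine group to a commutative
    group, which is trivial on commutators, hence on translations
    ([affine_semi_invariant]).  So the factors depend on sigma only, up to their
    multipliers, and the dependence on sigma is a character of the group of
    dilations times a power of sigma.  This settles inference about mu given
    sigma, but leaves the character undetermined in the other two cases, and it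
    need not be a power of sigma since no regularity of zeta is assumed.

    For sigma given mu = m, consider the reciprocal 1 / (X - m): it follows a
    scale family with parameter 1 / sigma.  The families of X - m and of its
    reciprocal are the two halves of one two-parameter family
    ([glued_family]), whose consistency factor is obtained on both halves by
    transformation from the one to be determined.  A dilation of the data is a
    symmetry of both halves, with the same multiplier, but it acts on the
    reciprocal half as the inverse dilation acts on the other one.  So the
    multiplier equals its inverse, and it is 1 because consistency factors have
    constant sign ([scale_family_consistency_factor]): the factor is 1 / sigma.

    For the joint factor, the product rule and Bayes' theorem, applied at the
    data (x1, x2) and at a given mu, show that the joint factor is proportional
    to the factor given mu at each sigma with
    phi((x1 - mu) / sigma) phi((x2 - mu) / sigma) <> 0.  If the set of these
    sigma has positive measure, then the unknown character is constant on a set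
    of positive measure, hence trivial
    ([multiplicative_constant_on_positive_measure]).

    The rest of the proof finds a mu for which these rules apply.  The data x1
    and x2 differ, because otherwise dilations about the common value would
    multiply the marginal density of sigma by a character, which is
    incompatible with a finite integral ([dilation_equivariant_not_density]).
    An inverse distribution of sigma given mu and x1 has to exist; existence at
    a single datum spreads to every location and datum on the same side of it
    ([inverse_exists_on_side]).  The two marginals have to be positive and
    finite: Tonelli's theorem bounds the integral over mu of one of them by a
    multiple of 1 / |x2 - x1|, the other one integrates to 1, and a symmetry
    argument shows that they are positive for a non-negligible set of mu on the
    side where the inverse distributions exist ([exists_location_with_finite_weights]). *)

(** * Affine and reciprocal substitutions in Lebesgue integrals *)

Section LebesgueSubstitution.
Variable R : realType.
Notation mu := (@lebesgue_measure R).

Lemma measurable_affine (a b : R) :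
  measurable_fun setT ((fun x => a * x + b) : R -> measurableTypeR R).
Proof. by apply: measurable_funD => //; apply: measurable_funM. Qed.

Lemma measurable_fun_inv : measurable_fun setT (@GRing.inv R).
Proof.
have -> : [set: R] = [set 0] `|` [set x | x != 0].
  by apply/seteqP; split => x // _ /=; have [->|] := eqVneq x 0; [left|right].
have op : open [set x : R | x != 0] by exact: open_neq.
apply/measurable_funU => //; first exact: open_measurable.
split; first exact: measurable_fun_set1.
apply: open_continuous_measurable_fun => //.
move=> x; rewrite inE /= => x0; exact: inv_continuous.
Qed.

Lemma lebesgue_measure_affine (a b : R) (A : set R) : a != 0 -> measurable A ->
  mu ((fun x => a * x + b) @^-1` A) = (`|a|^-1%:E * mu A)%E.
Proof.
move=> a0 mA.
have ma := measurable_affine a b.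
pose na : {nonneg R} := NngNum (normr_ge0 a).
pose f : R -> measurableTypeR R := fun x => a * x + b.
have [nu nuE] : exists nu : {measure set (measurableTypeR R) -> \bar R},
    forall B, nu B = (`|a|%:E * mu (f @^-1` B))%E.
  by unshelve eexists (mscale na (pushforward mu f)).
suff -> : mu A = nu A.
  by rewrite nuE muleA -EFinM mulVf ?mul1e// normr_eq0.
apply: lebesgue_measure_unique => // _ [[c d]] _ <-.
rewrite nuE /f lebesgue_measure_itv/= lte_fin.
have [ap|an] : 0 < a \/ a < 0 by case: (ltrgt0P a) a0 => // _ _; [left|right].
- have -> : (fun x => a * x + b) @^-1` `]c, d]%classic =
    `]((c - b) / a), ((d - b) / a)]%classic.
    apply/seteqP; split => x /=; rewrite !in_itv/= ltr_pdivrMr// ler_pdivlMr// => /andP[h1 h2];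
      apply/andP; split; lra.
  rewrite lebesgue_measure_itv/= lte_fin ltr_pM2r ?invr_gt0// ltrD2r.
  case: ifPn => _; last by rewrite mule0.
  by rewrite gtr0_norm// -EFinB -EFinB -EFinM; congr EFin; field.
- have -> : (fun x => a * x + b) @^-1` `]c, d]%classic =
    `[((d - b) / a), ((c - b) / a)[%classic.
    apply/seteqP; split => x /=; rewrite !in_itv/= ltr_ndivlMr// ler_ndivrMr// => /andP[h1 h2];
      apply/andP; split; lra.
  rewrite lebesgue_measure_itv/= lte_fin ltr_nM2r ?invr_lt0// ltrD2r.
  case: ifPn => _; last by rewrite mule0.
  by rewrite ltr0_norm// -EFinB -EFinB -EFinM; congr EFin; field.
Qed.

Lemma ge0_integral_affine (a b : R) (D : set R) (F : R -> \bar R) :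
  a != 0 -> measurable D -> measurable_fun D F ->
  (forall x, D x -> (0 <= F x)%E) ->
  (\int[mu]_(x in (fun x => (a * x + b)%R) @^-1` D) F (a * x + b)%R =
   `|a|^-1%:E * \int[mu]_(x in D) F x)%E.
Proof.
move=> a0 mD mF F0.
have ma := measurable_affine a b.
rewrite -(@ge0_integral_pushforward _ _ (measurableTypeR R) (measurableTypeR R) R _ ma mu D F)//; last first.
  by move=> x; rewrite inE; exact: F0.
have nai : 0 <= `|a|^-1 by rewrite invr_ge0.
pose na : {nonneg R} := NngNum nai.
rewrite -[RHS](ge0_integral_mscale mu mD na mF F0).
apply: eq_measure_integral => //= A mA _.
by rewrite /pushforward lebesgue_measure_affine.
Qed.

Let w (x : R) : \bar R := (`|x|^-1)%:E.

Let measurable_w : measurable_fun setT w.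
Proof.
apply/measurable_EFinP; apply: (measurableT_comp measurable_fun_inv).
exact: normr_measurable.
Qed.

Let w_ge0 x : (0 <= w x)%E. Proof. by rewrite lee_fin invr_ge0. Qed.

Lemma ge0_integral_haar_dilation (c : R) (F : R -> \bar R) :
  c != 0 -> measurable_fun setT F -> (forall x, (0 <= F x)%E) ->
  (\int[mu]_x (F (c * x)%R * w x) = \int[mu]_x (F x * w x))%E.
Proof.
move=> c0 mF F0.
have mFw : measurable_fun setT (fun x => F x * w x)%E by exact: emeasurable_funM.
have Fw0 x : (0 <= F x * w x)%E by rewrite mule_ge0.
have := @ge0_integral_affine c 0 setT _ c0 measurableT mFw (fun x _ => Fw0 x).
rewrite preimage_setT => h.
transitivity (`|c|%:E * \int[mu]_x (F (c * x + 0)%R * w (c * x + 0)%R))%E.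
  rewrite -ge0_integralZl//; last first.
    exact: measurableT_comp mFw (measurable_affine c 0).
  apply: eq_integral => x _; rewrite addr0 muleCA; congr (_ * _)%E.
  by rewrite /w -EFinM normrM invfM mulVKf// normr_eq0.
by rewrite h muleA -EFinM divff ?mul1e// normr_eq0.
Qed.

Lemma mule_pos_cancel (q x y : \bar R) :
  (0 < q)%E -> (q < +oo)%E -> (x * q = y * q)%E -> x = y.
Proof.
case: q => [q| |]//; rewrite lte_fin => q0 _ /(congr1 (fun z => z * q^-1%:E)%E).
by rewrite -!muleA -EFinM mulfV ?gt_eqF// !mule1.
Qed.

(** The measure dx / |x| is a Haar measure of the multiplicative group, and a
    Haar measure of a commutative group is invariant under inversion.  With a
    function Q of finite nonzero integral q, write q * \int F as a double
    integral of Q(x) F(y / x) by dilating y; dilating x by y turns this into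
    Q(x y) F(1 / x), and integrating over y first leaves q * \int F(1 / x). *)
Lemma ge0_integral_haar_inv (F : R -> \bar R) :
  measurable_fun setT F -> (forall x, (0 <= F x)%E) ->
  (\int[mu]_x (F (x^-1)%R * w x) = \int[mu]_x (F x * w x))%E.
Proof.
move=> mF F0.
(* the integral of Q(x) / |x| lies between 1 / 2 and 1 *)
pose Q (x : R) : \bar R := (\1_(`[1, 2]%classic : set R) x)%:E.
have mQ : measurable_fun setT Q by apply/measurable_EFinP; exact: measurable_indic.
have Q0 x : (0 <= Q x)%E by rewrite lee_fin.
have mFi : measurable_fun setT (fun x : R => F x^-1).
  exact: measurableT_comp mF measurable_fun_inv.
pose q := (\int[mu]_x (Q x * w x))%E.
have mw := measurable_w.
have [q0 qoo] : (0 < q /\ q < +oo)%E.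
  have -> : q = (\int[mu]_(x in `[1%R, 2%R]) w x)%E.
    rewrite [RHS]integral_mkcond; apply: eq_integral => x _.
    by rewrite /Q indicE patchE; case: ifPn => _; rewrite ?mul1e ?mul0e.
  have m12 : mu `[1, 2] = 1%E.
    by rewrite lebesgue_measure_itv/= lte_fin ltr1n -EFinB; congr EFin; lra.
  have wb x : x \in (`[1, 2]%classic : set R) -> 2^-1 <= `|x|^-1 <= 1.
    rewrite inE/= in_itv/= => /andP[x1 x2].
    rewrite ger0_norm; last lra.
    by apply/andP; split; [rewrite lef_pV2 ?posrE; lra|rewrite invf_le1; lra].
  split.
    apply: (@lt_le_trans _ _ (\int[mu]_(x in `[1%R, 2%R]) (cst (2^-1)%:E x))%E).
      by rewrite integral_cst//= m12 mule1 lte_fin.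
    apply: ge0_le_integral => //.
    - by move=> x _; rewrite lee_fin invr_ge0.
    - exact: measurable_funTS.
    - by move=> x /mem_set/wb/andP[? _]; rewrite lee_fin.
  apply: (@le_lt_trans _ _ (\int[mu]_(x in `[1%R, 2%R]) (cst 1%:E x))%E).
    apply: ge0_le_integral => //.
    - exact: measurable_funTS.
    - by move=> x /mem_set/wb/andP[_ ?]; rewrite lee_fin.
  by rewrite integral_cst//= m12 mule1 ltry.
pose H (z : R * R) : \bar R := (Q z.1 * w z.1 * (F (z.2 * z.1^-1)%R * w z.2))%E.
have mH : measurable_fun setT H.
  apply: emeasurable_funM; apply: emeasurable_funM.
  - exact: measurableT_comp mQ measurable_fst.
  - exact: measurableT_comp mw measurable_fst.
  - apply: measurableT_comp mF _; apply: measurable_funM => //.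
    exact: measurableT_comp measurable_fun_inv measurable_fst.
  - exact: measurableT_comp mw measurable_snd.
have H0 z : (0 <= H z)%E by rewrite !mule_ge0.
pose K (z : R * R) : \bar R := (F (z.1^-1)%R * w z.1 * (Q (z.1 * z.2)%R * w z.2))%E.
have mK : measurable_fun setT K.
  apply: emeasurable_funM; apply: emeasurable_funM.
  - exact: measurableT_comp mFi measurable_fst.
  - exact: measurableT_comp mw measurable_fst.
  - by apply: measurableT_comp mQ _; apply: measurable_funM.
  - exact: measurableT_comp mw measurable_snd.
have mFd (c : R) : measurable_fun setT (fun y : R => F (y * c)).
  by apply: measurableT_comp mF _; apply: measurable_funM.
have mFd' (c : R) : measurable_fun setT (fun x : R => F (c / x)).
  apply: measurableT_comp mF _; apply: measurable_funM => //.
  exact: measurable_fun_inv.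
have mQd (c : R) : measurable_fun setT (fun y : R => Q (c * y)).
  by apply: measurableT_comp mQ _; apply: measurable_funM.
have K0 z : (0 <= K z)%E by rewrite !mule_ge0.
pose If := (\int[mu]_x (F x * w x))%E.
pose Ig := (\int[mu]_x (F (x^-1)%R * w x))%E.
have If0 : (0 <= If)%E by apply: integral_ge0 => x _; rewrite mule_ge0.
have E1 : (\int[mu]_x \int[mu]_y H (x, y) = q * If)%E.
  rewrite -ge0_integralZr//; [|exact: emeasurable_funM|by move=> x _; rewrite mule_ge0].
  apply: eq_integral => x _; rewrite /H/=.
  rewrite ge0_integralZl//; [|by apply: emeasurable_funM => //; exact: mFd|
    by move=> y _; rewrite mule_ge0|by rewrite mule_ge0].
  have [->|x0] := eqVneq x 0; first by rewrite /w normr0 invr0 mule0 !mul0e.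
  congr (_ * _)%E; rewrite -[RHS](@ge0_integral_haar_dilation x^-1 F)// ?invr_eq0//.
  by apply: eq_integral => y _; rewrite mulrC.
have E2 : (\int[mu]_x \int[mu]_y K (x, y) = Ig * q)%E.
  rewrite -ge0_integralZr//; [|exact: emeasurable_funM|by move=> x _; rewrite mule_ge0|exact: ltW].
  apply: eq_integral => x _; rewrite /K/=.
  rewrite ge0_integralZl//; [|by apply: emeasurable_funM => //; exact: mQd|
    by move=> y _; rewrite mule_ge0|by rewrite mule_ge0].
  have [->|x0] := eqVneq x 0; first by rewrite /w normr0 invr0 mule0 !mul0e.
  by congr (_ * _)%E; rewrite (@ge0_integral_haar_dilation x).
have E3 : (\int[mu]_y \int[mu]_x H (x, y) = \int[mu]_y \int[mu]_x K (x, y))%E.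
  apply: eq_integral => y _; have [->|y0] := eqVneq y 0.
    by rewrite !integral0_eq// => x _; rewrite /H/K/= /w normr0 invr0 !mule0.
  transitivity (w y * \int[mu]_x (Q x * F (y / x)%R * w x))%E.
    rewrite -ge0_integralZl//; [|by apply: emeasurable_funM => //; apply: emeasurable_funM => //; exact: mFd'|
      by move=> x _; rewrite !mule_ge0].
    by apply: eq_integral => x _; rewrite /H/= muleC -!muleA muleCA; congr (_ * _)%E; rewrite muleCA.
  rewrite -(@ge0_integral_haar_dilation y (fun x => Q x * F (y / x)%R)%E)//;
    [|by apply: emeasurable_funM => //; exact: mFd'|by move=> x; rewrite mule_ge0].
  rewrite -ge0_integralZl//; [|apply: emeasurable_funM => //;
      apply: emeasurable_funM => //; first exact: mQd;
      exact: measurableT_comp (mFd' y) (mulrl_measurable y)|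
    by move=> x _; rewrite !mule_ge0].
  apply: eq_integral => x _; rewrite /K/=.
  have -> : y / (y * x) = x^-1 by rewrite invfM mulVKf.
  rewrite (mulrC y x) [RHS]muleC -!muleA; exact: muleCA.
apply: (mule_pos_cancel q0 qoo); rewrite -[LHS]E2 [RHS]muleC -[RHS]E1.
transitivity (\int[mu]_y \int[mu]_x K (x, y))%E; first exact: fubini_tonelli.
by apply: etrans (esym E3) _; apply/esym; exact: fubini_tonelli.
Qed.

Lemma ge0_integral_inv (F : R -> \bar R) :
  measurable_fun setT F -> (forall x, (0 <= F x)%E) ->
  (\int[mu]_x (F (x^-1)%R * (x ^- 2)%:E) = \int[mu]_x F x)%E.
Proof.
move=> mF F0.
have mn : measurable_fun setT (fun x : R => (`|x|)%:E) by exact/measurable_EFinP.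
have n0 (x : R) : (0 <= `|x|%:E)%E by rewrite lee_fin.
have := @ge0_integral_haar_inv (fun x => F x * `|x|%:E)%E.
move=> /(_ (emeasurable_funM mF mn) (fun x => mule_ge0 (F0 x) (n0 x))) h.
transitivity (\int[mu]_x (F (x^-1)%R * `|(x^-1)%R|%:E * w x))%E.
  apply: eq_integral => x _; rewrite -muleA; congr (_ * _)%E.
  by rewrite /w -EFinM normfV -expr2 -normfV -normrX ger0_norm ?sqr_ge0// exprVn.
rewrite h; have mw := measurable_w.
apply: ge0_ae_eq_integral => //.
- by apply: emeasurable_funM => //; exact: emeasurable_funM.
- by move=> x _; rewrite !mule_ge0.
exists [set 0]; split => //; first exact: lebesgue_measure_set1.
move=> x /=; apply: contra_notP => /eqP x0 _.
by rewrite -muleA /w -EFinM mulfV ?mule1// normr_eq0.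
Qed.

End LebesgueSubstitution.

(** * Rigidity under dilations *)

Section Dilations.
Variable R : realType.
Notation mu := (@lebesgue_measure R).

Lemma positive_halfline : [set x : R | 0 < x] = `]0, +oo[%classic.
Proof. by apply/seteqP; split => x /=; rewrite in_itv/= andbT. Qed.

Lemma measurable_positive_halfline : measurable [set x : R | 0 < x].
Proof. by rewrite positive_halfline. Qed.

(** Dilation by 2 shows that the multiplier of 2 has to be 1 / 2 if the integral
    is 1.  Then ]0, 1] and ]0, 2] carry the same mass, so q vanishes somewhere
    in ]1, 2], hence everywhere by equivariance. *)
Lemma dilation_equivariant_not_density (q : R -> \bar R) (kappa : R -> R) :
  measurable_fun [set x : R | 0 < x] q ->
  (forall x, 0 < x -> (0 <= q x)%E) ->
  (forall a, 0 < a -> 0 <= kappa a) ->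
  (forall a x, 0 < a -> 0 < x -> q (a * x) = ((kappa a)%:E * q x)%E) ->
  (\int[mu]_(x in [set x : R | (0 < x)%R]) q x)%E <> 1%E.
Proof.
move=> mq q0 kappa0 qE int1.
have mpos := measurable_positive_halfline.
have two0 : (2 : R) != 0 by [].
have k2 : kappa 2 = 2^-1.
  have := ge0_integral_affine 0 two0 mpos mq q0.
  rewrite int1 mule1 gtr0_norm//.
  have -> : (fun x : R => 2 * x + 0) @^-1` [set x | 0 < x] = [set x | 0 < x].
    by apply/seteqP; split => x /=; rewrite addr0 pmulr_rgt0.
  under eq_integral => x.
    rewrite inE/= => x0; rewrite addr0 qE//; over.
  by rewrite ge0_integralZl//= ?int1 ?mule1 ?lee_fin ?kappa0// => -[].
have sub02 : `]0, 2]%classic `<=` [set x : R | 0 < x].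
  by move=> x /=; rewrite in_itv/= => /andP[].
have sub01 : `]0, 1]%classic `<=` [set x : R | 0 < x].
  by move=> x /=; rewrite in_itv/= => /andP[].
have sub12 : `]1, 2]%classic `<=` [set x : R | 0 < x].
  by move=> x /=; rewrite in_itv/= => /andP[? _]; lra.
have E12 : `]0, 2]%classic = `]0, 1]%classic `|` `]1, 2]%classic :> set R.
  apply/seteqP; split => x /=; rewrite !in_itv/=.
    by move=> /andP[x0 x2]; case: (leP x 1) => x1; [left|right]; apply/andP.
  by move=> [] /andP[x0 x2]; apply/andP; split; lra.
have i02 : (\int[mu]_(x in `]0%R, 2%R]) q x = \int[mu]_(x in `]0%R, 1%R]) q x)%E.
  have := @ge0_integral_affine _ 2 0 `]0, 2]%classic q two0.
  move=> /(_ (measurable_itv _)).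
  move=> /(_ (measurable_funS mpos sub02 mq) (fun x h => q0 x (sub02 x h))).
  have -> : (fun x : R => 2 * x + 0) @^-1` `]0, 2] = `]0, 1]%classic.
    apply/seteqP; split => x /=; rewrite addr0 !in_itv/= => /andP[h1 h2];
    by apply/andP; split; lra.
  under eq_integral => x.
    rewrite inE/= in_itv/= => /andP[x0 _]; rewrite addr0 qE//; over.
  rewrite ge0_integralZl//=; last first.
  - by rewrite lee_fin kappa0.
  - by move=> x /sub01; exact: q0.
  - exact: measurable_funS mpos sub01 mq.
  rewrite k2 gtr0_norm// => /(congr1 (fun z => 2%:E * z)%E).
  by rewrite !muleA -EFinM mulfV// !mul1e.
have sub3 : `]0, 1]%classic `|` `]1, 2]%classic `<=` [set x : R | 0 < x].
  by rewrite -E12.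
have i12 : (\int[mu]_(x in `]1%R, 2%R]) q x = 0)%E.
  move: i02; rewrite E12 ge0_integral_setU//=; last first.
  - by apply/disj_setPS => x /= []; rewrite !in_itv/= => /andP[_ h1] /andP[/lt_le_trans/(_ h1)]; rewrite ltxx.
  - by move=> x /sub3; exact: q0.
  - exact: measurable_funS mpos sub3 mq.
  have : (\int[mu]_(x in `]0%R, 1%R]) q x \is a fin_num)%E.
    rewrite ge0_fin_numE; last by apply: integral_ge0 => x /sub01; exact: q0.
    apply: (@le_lt_trans _ _ 1%E); last exact: ltry.
    by rewrite -int1; apply: ge0_subset_integral.
  set A := (\int[mu]_(x in `]0%R, 1%R]) q x)%E => fin.
  by move=> /(congr1 (fun z => z - A)%E); rewrite [X in (X - _ = _)%E]addeC addeK// subee.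
have [x1 [x1I qx1]] : exists x, `]1, 2]%classic x /\ q x = 0%E.
  apply: contrapT => nex.
  have := @ae_eq_integral_abs _ _ _ mu `]1, 2]%classic (measurable_itv _) q (measurable_funS mpos sub12 mq).
  have -> : (\int[mu]_(x in `]1%R, 2%R]) `|q x| = 0)%E.
    rewrite -i12; apply: eq_integral => x; rewrite inE => /sub12 x0.
    by rewrite gee0_abs// q0.
  move=> [/(_ erefl) [N [mN N0 sub]] _].
  have : (mu `]1%R, 2%R]%classic <= mu N)%E.
    apply: le_measure; rewrite ?inE//.
    by move=> x xI; apply: sub => /= /(_ xI) qx; apply: nex; exists x.
  by rewrite N0 lebesgue_measure_itv/= lte_fin ltr1n -EFinB lee_fin; lra.
have x10 := sub12 _ x1I.
have : (\int[mu]_(x in [set x : R | (0 < x)%R]) q x = 0)%E.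
  apply: integral0_eq => x /= x0; rewrite -(divfK (lt0r_neq0 x10) x).
  by rewrite qE ?divr_gt0// qx1 mule0.
by rewrite int1 => /eqP; rewrite onee_eq0.
Qed.

(** If psi a <> 1, the values of psi at the roots r k := a ^ (1 / (k + 1)) are
    pairwise distinct, so the dilates r k * T of a bounded part T of S are
    disjoint.  They have at least the measure of T and lie in one bounded
    interval, which is impossible. *)
Lemma multiplicative_constant_on_gt1 (psi : R -> R) (S : set R) (a : R) :
  (forall x y, 0 < x -> 0 < y -> psi (x * y) = psi x * psi y) ->
  (forall x, 0 < x -> 0 < psi x) ->
  measurable S -> S `<=` [set x | 0 < x] -> mu S != 0%E ->
  (forall x y, S x -> S y -> psi x = psi y) ->
  1 < a -> psi a = 1.
Proof.
move=> psiM psi0 mS Spos S0 psiS a1.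
apply: contrapT => psia.
have a0 : 0 < a by lra.
have psi1 : psi 1 = 1.
  have p0 : psi 1 != 0 by rewrite gt_eqF ?psi0.
  by apply: (mulfI p0); rewrite mulr1 -psiM// mulr1.
have psiX n x : 0 < x -> psi (x ^+ n) = psi x ^+ n.
  by move=> x0; elim: n => [|n ih]; rewrite ?expr0// !exprS psiM ?exprn_gt0// ih.
have [n Tn0] : exists n : nat, mu (S `&` `[0, n%:R]) != 0%E.
  apply: contrapT => nex.
  move/negP: S0; apply; apply/eqP/negligibleP => //.
  have : mu.-negligible (\bigcup_n (S `&` `[0, n%:R])).
    apply: negligible_bigcup => n; apply/negligibleP; first exact: measurableI.
    by apply: contrapT => /eqP h; apply: nex; exists n.
  apply: negligibleS => x Sx; exists (Num.truncn x).+1 => //; split => //=.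
  by rewrite in_itv/= (ltW (Spos _ Sx))/= ltW// truncnS_gt.
set T := S `&` `[0, n%:R] in Tn0.
have mT : measurable T by exact: measurableI.
have Tub : (mu T <= n%:R%:E)%E.
  apply: (@le_trans _ _ (mu `[0%R, n%:R]%classic)).
    by apply: le_measure; rewrite ?inE//; exact: subIsetr.
  rewrite lebesgue_measure_itv/= lte_fin; case: ifPn => _; last by rewrite lee_fin.
  by rewrite -EFinB subr0.
have Tfin : mu T \is a fin_num by rewrite ge0_fin_numE// (le_lt_trans Tub)// ltry.
have t0 : 0 < fine (mu T).
  by rewrite fine_gt0// lt0e Tn0 measure_ge0/= -ge0_fin_numE.
(* the exponents are 1, 1 / 2, 1 / 3 and so on, hence the shift by one *)
pose r (k : nat) := a `^ (k.+1%:R^-1).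
have r0 k : 0 < r k by exact: powR_gt0.
have rX k : r k ^+ k.+1 = a.
  by rewrite -powR_mulrn ?ltW// /r -powRrM mulVf// powRr1// ltW.
have r1 k : 1 <= r k.
  rewrite leNgt; apply/negP => rk; have := rX k.
  have := @ler_iXnr _ (r k) k.+1 isT (ltW (r0 k)) (ltW rk); lra.
have ra k : r k <= a by have := @ler_eXnr _ (r k) k.+1 isT (r1 k); rewrite rX.
pose Tk k := (fun x => (r k)^-1 * x + 0) @^-1` T.
have muTk k : mu (Tk k) = ((r k)%:E * mu T)%E.
  rewrite lebesgue_measure_affine// ?invr_neq0 ?gt_eqF//.
  by rewrite gtr0_norm ?invr_gt0// invrK.
have mTk k : measurable (Tk k).
  by rewrite -[Tk k]setTI; apply: measurable_affine.
have psir i j : psi (r i) = psi (r j) -> i = j.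
  have pj1 : psi (r j) != 1.
    by apply/eqP => p1; apply: psia; rewrite -(rX j) psiX// p1 expr1n.
  move=> rij; apply: succn_inj; apply: (ieexprIn (psi0 _ (r0 j)) pj1).
  by rewrite -{1}rij -!psiX// !rX.
have triv : trivIset setT Tk.
  move=> i j _ _ [x [[]]]; rewrite /= addr0 => Six _ [Sjx _].
  move: Sjx; rewrite /= addr0 => Sjx; apply: psir.
  have x0 : 0 < x by have := Spos _ Six; rewrite /= pmulr_rgt0// invr_gt0.
  have h := psiS _ _ Six Sjx.
  have ei : psi x = psi (r i) * psi ((r i)^-1 * x).
    by rewrite -psiM ?mulVKf ?gt_eqF// mulr_gt0// invr_gt0.
  have ej : psi x = psi (r j) * psi ((r j)^-1 * x).
    by rewrite -psiM ?mulVKf ?gt_eqF// mulr_gt0// invr_gt0.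
  apply: (@mulIf _ (psi ((r i)^-1 * x))); last by rewrite -ei h -ej.
  by rewrite gt_eqF// psi0// mulr_gt0// invr_gt0.
have bound N : N%:R * fine (mu T) <= n%:R * a.
  have : (mu (\big[setU/set0]_(k < N) Tk k) <= mu `[0%R, (n%:R * a)%R]%classic)%E.
    apply: le_measure; rewrite ?inE//; first by apply: bigsetU_measurable => k _; exact: mTk.
    move=> x; rewrite -bigcup_mkord => -[k _ []] /=; rewrite addr0 !in_itv/= => Sx /andP[h1 h2].
    have x0 : 0 < x by have := Spos _ Sx; rewrite /= pmulr_rgt0// invr_gt0.
    rewrite (ltW x0)/=; move: h2; rewrite mulrC ler_pdivrMr// => /le_trans; apply.
    by rewrite ler_wpM2l.
  rewrite measure_semi_additive_ord_I//; last 3 first.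
  - by move=> k _; exact: mTk.
  - exact: sub_trivIset triv.
  - by apply: bigsetU_measurable => k _; exact: mTk.
  rewrite lebesgue_measure_itv/= lte_fin -EFinB subr0 => h.
  have : (\sum_(k < N) (fine (mu T))%:E <= (n%:R * a)%:E)%E.
    apply: (@le_trans _ _ (\sum_(k < N) mu (Tk k))%E).
      apply: lee_sum => k _; rewrite muTk -{2}(fineK Tfin) -EFinM lee_fin.
      by rewrite ler_peMl// ltW.
    by move: h; case: ifPn => // _ /le_trans; apply; rewrite lee_fin mulr_ge0// ltW.
  by rewrite sumEFin lee_fin sumr_const card_ord -[X in X <= _ -> _]mulr_natl.
have := bound (Num.truncn (n%:R * a / fine (mu T))).+1.
by rewrite leNgt -ltr_pdivrMr// truncnS_gt.
Qed.

Lemma multiplicative_constant_on_positive_measure (psi : R -> R) (S : set R) :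
  (forall x y, 0 < x -> 0 < y -> psi (x * y) = psi x * psi y) ->
  (forall x, 0 < x -> 0 < psi x) ->
  measurable S -> S `<=` [set x | 0 < x] -> mu S != 0%E ->
  (forall x y, S x -> S y -> psi x = psi y) ->
  forall a, 0 < a -> psi a = 1.
Proof.
move=> psiM psi0 mS Spos S0 psiS.
have gt1 a : 1 < a -> psi a = 1 by exact: multiplicative_constant_on_gt1 S0 psiS.
have psi1 : psi 1 = 1.
  have := gt1 (2 * 1); rewrite psiM// gt1 ?ltr1n// mul1r mulr1.
  by apply; rewrite ltr1n.
move=> a a0; case: (ltgtP a 1) => [a1|/gt1//|-> //].
have := psiM a a^-1; rewrite invr_gt0 => /(_ a0 a0).
by rewrite mulfV ?gt_eqF// psi1 (gt1 a^-1) ?invf_gt1// mulr1 => <-.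
Qed.

End Dilations.

(** * Semi-invariant functions on the half-plane *)

Section AffineSemiInvariance.
Variable R : realType.

(** Going from (0, 1) to (2 m, 2) along two paths, the translation by m followed
    by the dilation by 2, or the dilation followed by two translations, shows
    that the multiplier of the translation equals its square. *)
Lemma affine_semi_invariant (W : R * R -> R) :
  (forall theta, 0 < theta.2 -> W theta != 0) ->
  (forall a b : R, 0 < a -> exists c, forall theta, 0 < theta.2 ->
     W (a * theta.1 + b, a * theta.2) = c * W theta) ->
  (forall theta, 0 < theta.2 -> W theta = W (0, theta.2)) /\
  (forall a b, 0 < a -> 0 < b ->
     W (0, a * b) * W (0, 1) = W (0, a) * W (0, b)).
Proof.
move=> W0 Wc; split.
- move=> [m s] /= s0; have [c1 h1] := Wc 1 m ltr01.
  have two0 : (0 : R) < 2 by [].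
  have [c2 h2] := Wc 2 0 two0.
  have e1 := h2 (m, 1) ltr01; have e2 := h1 (0, 1) ltr01.
  have e3 := h1 (m, 2) two0; have e4 := h1 (0, 2) two0.
  have e5 := h2 (0, 1) ltr01.
  move: e1 e2 e3 e4 e5; rewrite /= !(mul1r, mulr1, add0r, mulr0, addr0) => e1 e2 e3 e4 e5.
  have w2 : W (m, 2) != 0 by exact: W0.
  have mm : W (m + m, 2) = W (m, 2).
    have -> : m + m = 2 * m by rewrite mulrDl mul1r.
    by rewrite e1 e2 e4 e5 mulrCA.
  have c11 : c1 = 1 by apply: (mulIf w2); rewrite -e3 mm mul1r.
  by have := h1 (0, s) s0; rewrite /= !mul1r add0r c11 mul1r.
- move=> a b a0 b0; have [c h] := Wc a 0 a0.
  have := h (0, b) b0; have := h (0, 1) ltr01.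
  rewrite /= !(mulr0, addr0, mulr1) => -> ->; ring.
Qed.

End AffineSemiInvariance.

(** * Regularity of affine maps and reciprocals *)

Section Regularity.
Variable R : realType.

Lemma is_derive_affine (a b x : R) : is_derive x 1 (fun y : R => a * y + b) a.
Proof.
have -> : (fun y : R => a * y + b) = a *: id + cst b by [].
by apply: is_derive_eq; rewrite addr0; exact: mulr1.
Qed.

Lemma is_derive_shift_inv (m x : R) : x != m ->
  is_derive x 1 (fun y : R => (y - m)^-1) (- (x - m) ^- 2).
Proof.
move=> xm.
have h : is_derive x 1 (fun y : R => y - m) 1.
  have -> : (fun y : R => y - m) = (fun y : R => 1 * y + - m).
    by apply/funext => y; rewrite mul1r.
  exact: is_derive_affine.
have xm0 : x - m != 0 by rewrite subr_eq0.
have D := is_deriveV (f := fun y : R => y - m) xm0 h.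
have -> : - (x - m) ^- 2 = - (x - m) ^- 2 *: (1 : R) by rewrite /GRing.scale/= mulr1.
exact: D.
Qed.

Lemma derive1_affine (a b x : R) : derive1 (fun y : R => a * y + b) x = a.
Proof. by rewrite derive1E (derive_val (is_derive := is_derive_affine a b x)). Qed.

Lemma derive1_shift_inv (m x : R) : x != m ->
  derive1 (fun y : R => (y - m)^-1) x = - (x - m) ^- 2.
Proof.
by move=> xm; rewrite derive1E (derive_val (is_derive := is_derive_shift_inv xm)).
Qed.

Lemma regular1_affine (D : set R) (a b : R) : a != 0 ->
  regular1 D (fun y => a * y + b).
Proof.
move=> a0; split.
  by move=> x y _ _ /addIr /(mulfI a0).
by move=> x _; rewrite derive1_affine.
Qed.

Lemma regular1_shift_inv (D : set R) (m : R) : (forall x, D x -> x != m) ->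
  regular1 D (fun y => (y - m)^-1).
Proof.
move=> Dm; split.
  by move=> x y _ _ /invr_inj /addIr.
move=> x /Dm xm; rewrite derive1_shift_inv//; split.
  by have [] := is_derive_shift_inv xm.
by rewrite oppr_eq0 invr_eq0 expf_neq0// subr_eq0.
Qed.

End Regularity.

(** * Densities of affine images and reciprocals *)

Section Densities.
Variable R : realType.
Notation mu := (@lebesgue_measure R).

(** The density of 1 / X when X has density p. *)
Definition reciprocal (p : R -> R) (y : R) : R := p y^-1 * y ^- 2.

Lemma is_density_location_scale (p : R -> R) (m s : R) :
  is_density (@leb1 R) setT p -> 0 < s ->
  is_density (@leb1 R) setT (fun x => s^-1 * p ((x - m) / s)).
Proof.
move=> [mp p0 p1] s0.
have E x : (x - m) / s = s^-1 * x + - (m / s) by rewrite mulrBl mulrC.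
have mps : measurable_fun setT (fun x : R => p ((x - m) / s)).
  under eq_fun do rewrite E.
  exact: measurableT_comp mp (measurable_affine _ _).
split.
- exact: measurable_funM.
- by move=> x _; rewrite mulr_ge0 ?invr_ge0 ?(ltW s0)// p0.
- under eq_integral do rewrite EFinM.
  rewrite ge0_integralZl//; last 3 first.
  + exact/measurable_EFinP.
  + by move=> x _; rewrite lee_fin p0.
  + by rewrite lee_fin invr_ge0 ltW.
  have si0 : s^-1 != 0 by rewrite invr_eq0 gt_eqF.
  have mpE : measurable_fun setT (fun x : R => (p x)%:E) by exact/measurable_EFinP.
  have pE0 x : setT x -> (0 <= (p x)%:E)%E by move=> ?; rewrite lee_fin p0.
  have := ge0_integral_affine (- (m / s)) si0 measurableT mpE pE0.
  rewrite preimage_setT gtr0_norm ?invr_gt0// invrK => h.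
  under eq_integral do rewrite E.
  by rewrite h /= p1 mule1 -EFinM mulVf// gt_eqF.
Qed.

Lemma is_density_reciprocal (p : R -> R) :
  is_density (@leb1 R) setT p -> is_density (@leb1 R) setT (reciprocal p).
Proof.
move=> [mp p0 p1]; split.
- apply: measurable_funM.
    exact: measurableT_comp mp (@measurable_fun_inv R).
  by apply: measurableT_comp (@measurable_fun_inv R) _; exact: measurable_funX.
- by move=> x _; rewrite mulr_ge0 ?p0// invr_ge0 sqr_ge0.
- rewrite -p1 -(@ge0_integral_inv R (fun x => (p x)%:E)).
  + by apply: eq_integral => x _; rewrite -EFinM.
  + exact/measurable_EFinP.
  + by move=> x; rewrite lee_fin p0.
Qed.

Lemma is_density_integral_neq (p : R -> R) (m : R) :
  is_density (@leb1 R) setT p ->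
  (\int[@leb1 R]_(x in [set x | x != m]) (p x)%:E = 1)%E.
Proof.
move=> [mp p0 p1]; rewrite -p1.
rewrite [RHS](@ge0_negligible_integral _ _ _ (@leb1 R) setT [set m])//.
- by congr (integral _ _ _); apply/seteqP; split => x /=; [move=> /eqP ?; split|case=> _ /eqP].
- exact/measurable_EFinP.
- exact: lebesgue_measure_set1.
Qed.

End Densities.

(** * Scale families *)

Section ScaleFamilies.
Variable R : realType.
Notation mu := (@lebesgue_measure R).

(** The location m is part of the definition because fixing mu in a
    location-scale family leaves a scale family centred at mu. *)
Definition scale_family (p : R -> R) (m : R) (K : parametric_family R R R) :=
  params K = [set s | 0 < s] /\
  forall s x, 0 < s -> dens K s x = s^-1 * p ((x - m) / s).

Variables (p : R -> R) (p_density : is_density (@leb1 R) setT p).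

Lemma scale_family_dens_density m K s : scale_family p m K -> 0 < s ->
  is_density (@leb1 R) setT (dens K s).
Proof.
move=> [_ KE] s0.
have -> : dens K s = fun x => s^-1 * p ((x - m) / s) by apply/funext => x; exact: KE.
exact: is_density_location_scale.
Qed.

Lemma scale_family_direct m K : scale_family p m K -> is_direct (@leb1 R) K.
Proof.
move=> scK; have [KP _] := scK; split; first by rewrite KP; exact: open_gt.
by move=> s; rewrite KP; exact: scale_family_dens_density scK.
Qed.

Lemma scale_family_affine a m m' K K' : 0 < a ->
  scale_family p m K -> scale_family p m' K' ->
  transformed1 setT (fun x => a * x + (m' - a * m)) (fun s => a * s + 0) K K'.
Proof.
move=> a0 scK scK'; have [KP KE] := scK; have [KP' KE'] := scK'.
split; [exact: openT|by apply: regular1_affine; rewrite gt_eqF|split].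
- rewrite KP KP'; apply/seteqP; split => s /=.
    move=> s0; exists (s / a); first exact: divr_gt0.
    by rewrite addr0 mulrC divfK// gt_eqF.
  by move=> [t t0 <-]; rewrite addr0 mulr_gt0.
- by move=> s; rewrite KP => s0; have [] := scale_family_dens_density scK s0.
- move=> s x; rewrite KP => /= s0 _; rewrite derive1_affine addr0 gtr0_norm//.
  rewrite KE// KE' ?mulr_gt0//.
  have -> : (a * x + (m' - a * m) - m') / (a * s) = (x - m) / s.
    by field; rewrite !gt_eqF.
  by field; rewrite !gt_eqF.
Qed.

Lemma scale_family_reciprocal m K K' :
  scale_family p m K -> scale_family (reciprocal p) 0 K' ->
  transformed1 [set x | x != m] (fun x => (x - m)^-1) (fun s => (s - 0)^-1) K K'.
Proof.
move=> scK scK'; have [KP KE] := scK; have [KP' KE'] := scK'.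
split; [exact: open_neq|exact: regular1_shift_inv|split].
- rewrite KP KP'; apply/seteqP; split => s /=.
    by move=> s0; exists s^-1; rewrite /= ?invr_gt0// subr0 invrK.
  by move=> [t t0 <-]; rewrite subr0 invr_gt0.
- move=> s; rewrite KP => s0; apply: is_density_integral_neq.
  exact: scale_family_dens_density scK s0.
- move=> s x; rewrite KP => /= s0 xm; rewrite derive1_shift_inv// subr0.
  rewrite KE// KE' ?invr_gt0// /reciprocal subr0 invrK.
  rewrite normrN ger0_norm ?invr_ge0 ?sqr_ge0//.
  have -> : ((x - m)^-1 * s)^-1 = (x - m) / s by rewrite invfM invrK mulrC.
  have sn0 : s != 0 by rewrite gt_eqF.
  have xm0 : x - m != 0 by rewrite subr_eq0.
  by field; rewrite sn0 xm0.
Qed.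

End ScaleFamilies.

(** * Inference about a scale parameter *)

Section OneParameterInference.
Variables (R : realType) (T : inverse_assignment R).
Hypothesis hT : obeys_inverse_rules T.

(** The normalization at y is the one at the preimage r y divided by the Jacobian
    of s.  The change of data s is only defined on U, so data outside U and
    outside its image have to be excluded separately. *)
Lemma consistency_factor_transformed (K K' : parametric_family R R R)
    (U : set R) (s r sb z z' : R -> R) :
  is_direct (@leb1 R) K -> is_direct (@leb1 R) K' ->
  regular1 (params K) sb -> transformed1 U s sb K K' ->
  (forall x, U x -> r (s x) = x) ->
  (forall x, ~ U x -> inv11 T K x = None) ->
  (forall y, ~ (s @` U) y -> inv11 T K' y = None) ->
  (forall t, params K t -> z t = z' (sb t) * `|derive1 sb t|) ->
  consistency_factor K (inv11 T K) z -> consistency_factor K' (inv11 T K') z'.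
Proof.
move=> dK dK' regsb tr rK outK outK' zz' [[x0 ex0] zsgn [eta etaP]].
have [_ [trI _ _] _ _ _] := hT.
have [_ regs [KK' _ densE]] := tr.
have sb'0 t : params K t -> 0 < `|derive1 sb t|.
  by move=> Kt; rewrite normr_gt0; have [_ /(_ _ Kt) []] := regsb.
have s'0 x : U x -> `|derive1 s x| != 0.
  by move=> Ux; rewrite normr_eq0; have [_ /(_ _ Ux) []] := regs.
have invK x := trI K K' U s sb dK dK' regsb tr x.
split.
- have Ux0 : U x0 by apply: contrapT => /outK h; rewrite h in ex0.
  exists (s x0); have := invK _ Ux0.
  by move: ex0; case: (inv11 T K x0) => // g _; case: (inv11 T K' (s x0)).
- case: zsgn => zsgn; [left|right]; rewrite KK' => _ [t Kt <-].
    by have := zsgn _ Kt; rewrite zz'// pmulr_lgt0// sb'0.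
  by have := zsgn _ Kt; rewrite zz'// pmulr_llt0// sb'0.
- exists (fun y => eta (r y) / `|derive1 s (r y)|) => y g' g'E.
  have [Uy|/outK'] := pselect ((s @` U) y); last by rewrite g'E.
  case: Uy g'E => x Ux <- g'E; rewrite rK//.
  have := invK _ Ux; rewrite g'E; case gE : (inv11 T K x) => [g|//] gg'.
  have [eta0 gz] := etaP _ _ gE; split.
    by rewrite mulf_neq0// invr_eq0 s'0.
  rewrite KK' => _ [t Kt <-].
  apply: (mulIf (lt0r_neq0 (sb'0 _ Kt))).
  rewrite -gg'// gz// densE// zz'//.
  have h1 := s'0 _ Ux.
  by field; rewrite eta0 h1.
Qed.

(** The datum m is fixed by the dilations about m, so an inverse density g at m
    would satisfy g(a t) = g(t) / a, which is not integrable. *)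
Lemma scale_family_no_inverse_at_center (p : R -> R) (m : R)
    (K : parametric_family R R R) :
  is_density (@leb1 R) setT p -> scale_family p m K -> inv11 T K m = None.
Proof.
move=> dp scK; have [[ex _ _] [trI _ _] _ _ _] := hT.
have dK := scale_family_direct dp scK; have [KP _] := scK.
case gE : (inv11 T K m) => [g|//]; exfalso.
have [[mg g0 g1] _] := ex _ _ _ dK gE.
have gM a t : 0 < a -> 0 < t -> g (a * t) = a^-1 * g t.
  move=> a0 t0; have an0 : a != 0 by rewrite gt_eqF.
  have := trI K K _ _ _ dK dK (regular1_affine _ 0 an0) (scale_family_affine dp a0 scK scK) m I.
  have -> : a * m + (m - a * m) = m by ring.
  rewrite gE => /(_ t); rewrite KP => /(_ t0).
  by rewrite derive1_affine addr0 gtr0_norm// => ->; rewrite [RHS]mulrC mulfK.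
rewrite KP in mg g0 g1.
apply: (@dilation_equivariant_not_density R (fun t => (g t)%:E) GRing.inv) g1.
- exact/measurable_EFinP.
- by move=> x x0; rewrite lee_fin g0.
- by move=> a a0; rewrite invr_ge0 ltW.
- by move=> a x a0 x0; rewrite gM// EFinM.
Qed.

(** The sign of the second parameter tells whether X or 1 / X is observed; it
    ranges over an open set because parameter spaces are open. *)
Definition glued_family (p : R -> R) : parametric_family R R (R * R) :=
  Family [set t | 0 < t.1 /\ t.2 != 0]
    (fun t y => t.1^-1 * (if 0 < t.2 then p else reciprocal p) (y / t.1)).

Lemma glued_family_fix2 (p : R -> R) (t : R) : t != 0 ->
  scale_family (if 0 < t then p else reciprocal p) 0 (fix2 (glued_family p) t).
Proof.
move=> t0; split; first by apply/seteqP; split => s /=; [case|].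
by move=> s x s0; rewrite subr0.
Qed.

Lemma glued_family_direct (p : R -> R) :
  is_density (@leb1 R) setT p -> is_direct (@leb1 R) (glued_family p).
Proof.
move=> dp; split.
  have -> : params (glued_family p) =
      fst @^-1` [set x : R | 0 < x] `&` snd @^-1` [set x : R | x != 0] by [].
  apply: openI.
    by apply: open_comp; [move=> x _; exact: cvg_fst|exact: open_gt].
  by apply: open_comp; [move=> x _; exact: cvg_snd|exact: open_neq].
move=> [s t] /= [s0 t0].
have := scale_family_dens_density _ (glued_family_fix2 p t0) s0.
by apply; case: ifP => // _; exact: is_density_reciprocal.
Qed.

Lemma glued_family_dilation (p : R -> R) (b : R) :
  is_density (@leb1 R) setT p -> 0 < b ->
  transformed1 setT (fun x => b * x + (0 - b * 0))
    (separate (fun s => b * s + 0) (fun t => 1 * t + 0))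
    (glued_family p) (glued_family p).
Proof.
move=> dp b0.
have dt (t : R) : is_density (@leb1 R) setT (if 0 < t then p else reciprocal p).
  by case: ifP => // _; exact: is_density_reciprocal.
split; [exact: openT|by apply: regular1_affine; rewrite gt_eqF|split].
- apply/seteqP; split => -[s t] /=.
    move=> [s0 t0]; exists (s / b, t) => /=; first by rewrite divr_gt0.
    by rewrite /separate/= !addr0 mul1r mulrC divfK// gt_eqF.
  by move=> [[s' t'] /= [s0 t0]] []; rewrite !addr0 mul1r => <- <-; rewrite mulr_gt0.
- by move=> t /(proj2 (glued_family_direct dp)) [].
- move=> [s t] x [/= s0 t0] _.
  have sc := glued_family_fix2 p t0.
  have [_ _ [_ _ /(_ s x)]] := scale_family_affine (dt t) b0 sc sc.
  have -> : 1 * t + 0 = t by rewrite mul1r addr0.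
  by apply.
Qed.

(** The consistency factor z of K is transported to both halves of
    [glued_family p]: it becomes z(t) on the half of X - m and z(1 / t) / t^2 on
    the half of the reciprocal.  Comparing the invariance under one dilation on
    the two halves gives z(b) b = chi z(1) and z(1) = chi z(b) b. *)
Lemma scale_family_consistency_factor (p : R -> R) (m : R)
    (K : parametric_family R R R) (z : R -> R) :
  is_density (@leb1 R) setT p -> scale_family p m K ->
  consistency_factor K (inv11 T K) z ->
  exists2 c, c != 0 & forall s, 0 < s -> z s = c * s^-1.
Proof.
move=> dp scK cfK.
have dr := is_density_reciprocal dp.
have dK := scale_family_direct dp scK; have [KP _] := scK.
pose J := glued_family p.
pose zJ (t : R * R) := if 0 < t.2 then z t.1 else z t.1^-1 * t.1 ^- 2.
have one0 : (1 : R) != 0 by [].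
have cfJ : cfactor_given2 T J zJ.
  move=> t [s0 [/= _ t0]].
  have := glued_family_fix2 p t0; rewrite /zJ/=; case: ifP => tpos scJ.
    apply: (consistency_factor_transformed (r := fun y => y + m) dK
      (scale_family_direct dp scJ) (regular1_affine _ 0 one0)
      (scale_family_affine dp ltr01 scK scJ) _ _ _ _ cfK) => //.
    + by move=> x _; ring.
    + by move=> x [].
    + by move=> y ny; case: ny; exists (y + m) => //; ring.
    + by move=> s _; rewrite derive1_affine normr1 mulr1 mul1r addr0.
  apply: (consistency_factor_transformed (r := fun y => y^-1 + m) dK
      (scale_family_direct dr scJ) _ (scale_family_reciprocal dp scK scJ) _ _ _ _ cfK) => //.
  + by apply: regular1_shift_inv => x; rewrite KP => /= x0; rewrite gt_eqF.
  + by move=> x xm; rewrite invrK subrK.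
  + by move=> x /negP/negPn/eqP ->; exact: scale_family_no_inverse_at_center scK.
  + move=> y ny; have [->|y0] := eqVneq y 0.
      exact: scale_family_no_inverse_at_center scJ.
    case: ny; exists (y^-1 + m) => /=; last by rewrite addrK invrK.
    by rewrite -subr_eq0 addrK invr_eq0.
  + move=> s; rewrite KP => /= sp; rewrite derive1_shift_inv ?gt_eqF// subr0 invrK.
    rewrite normrN ger0_norm ?invr_ge0 ?sqr_ge0//.
    by field; rewrite gt_eqF.
have [_ _ _ _ [inv2 _ _]] := hT.
have [k k0 kinv] := inv2 J zJ (glued_family_direct dp) cfJ.
have zsgn : (forall s, 0 < s -> 0 < z s) \/ (forall s, 0 < s -> z s < 0).
  by case: cfK => _ + _; rewrite KP.
have z1 : z 1 != 0.
  by case: zsgn => /(_ 1 ltr01) h; [rewrite gt_eqF|rewrite lt_eqF].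
exists (z 1) => // b b0.
have bn0 : b != 0 by rewrite gt_eqF.
have reg : regular_separate (params J) (fun s => b * s + 0) (fun t => 1 * t + 0).
  by split; exact: regular1_affine.
have [chi chiP] := kinv _ _ _ _ reg (glued_family_dilation dp b0).
have kp : k 1 != 0 by apply: (k0 (1, 1)); split => //=.
have kn : k (-1) != 0 by apply: (k0 (1, -1)); split => //=; rewrite oppr_eq0.
have Jp : params J (1, 1) by split => /=.
have Jn : params J (b^-1, -1) by split => /=; rewrite ?invr_gt0// oppr_eq0.
have n1 : (0 < (-1) :> R) = false by rewrite oppr_gt0 ltr10.
(* the same multiplier chi on both halves: from (1, 1) to (b, 1) and from
   (1 / b, -1) to (1, -1) *)
have := chiP _ Jn; have := chiP _ Jp.
rewrite /zJ /separate/= !derive1_affine !(addr0, mul1r, mulr1, invrK, ltr01, n1).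
rewrite (gtr0_norm b0) mulfV// invr1 expr1n invr1 !mulr1.
rewrite exprVn invrK => e1 e2.
have v1 : z b * b = chi * z 1 by apply: (mulfI kp); rewrite mulrA e1; ring.
have v2 : z 1 = chi * (z b * b).
  by apply: (mulIf bn0); apply: (mulfI kn); rewrite mulrA e2; ring.
have /eqP : (z b * b - z 1) * (z b * b + z 1) = 0.
  have -> : (z b * b - z 1) * (z b * b + z 1) = (z b * b) * (z b * b) - z 1 * z 1 by ring.
  by rewrite {1}v1 {2}v2; ring.
rewrite mulf_eq0 subr_eq0 => /orP[/eqP <-|/eqP vz]; first by rewrite mulfK.
exfalso; case: zsgn => zs; have := zs b b0; have := zs 1 ltr01 => h1 h2.
  have h3 : 0 < z b * b by exact: mulr_gt0.
  by have := addr_gt0 h3 h1; rewrite vz ltxx.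
have h3 : z b * b < 0 by rewrite nmulr_rlt0.
by have := ltrD h3 h1; rewrite vz addr0 ltxx.
Qed.

End OneParameterInference.

(** * Integrals of products of densities at two data *)

Section Integrals.
Variable R : realType.
Notation mu := (@lebesgue_measure R).

(** A null integral forces f to vanish almost everywhere, so h does as well. *)
Lemma ge0_integral_eq0_support d (X : measurableType d)
    (m : {measure set X -> \bar R}) (D : set X) (f h : X -> \bar R) :
  measurable D -> measurable_fun D f -> measurable_fun D h ->
  (forall x, D x -> (0 <= f x)%E) -> (forall x, D x -> (0 <= h x)%E) ->
  (forall x, D x -> f x = 0%E -> h x = 0%E) ->
  (\int[m]_(x in D) f x = 0)%E -> (\int[m]_(x in D) h x = 0)%E.
Proof.
move=> mD mf mh f0 h0 fh intf.
have f_ae : ae_eq m D f (cst 0%E).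
  apply/(ae_eq_integral_abs m mD mf).1; rewrite -[RHS]intf.
  by apply: eq_integral => x; rewrite inE => Dx; rewrite gee0_abs// f0.
have h_ae : ae_eq m D h (cst 0%E).
  by apply: filterS f_ae => x fx Dx; apply: fh => //; exact: fx.
rewrite -[RHS](integral0 m D); apply: ge0_ae_eq_integral => //.
Qed.

Lemma ge0_integral_lty_ae d (X : measurableType d)
    (m : {measure set X -> \bar R}) (f : X -> \bar R) :
  measurable_fun setT f -> (forall x, (0 <= f x)%E) ->
  (\int[m]_x f x < +oo)%E -> {ae m, forall x, (f x < +oo)%E}.
Proof.
move=> mf f0 foo.
have intf : m.-integrable setT f.
  apply/integrableP; split => //.
  by under eq_integral do rewrite gee0_abs//.
have := integrable_ae measurableT intf.
by apply: filterS => x /(_ I); rewrite ge0_fin_numE.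
Qed.

(** Real-valued, so that it can be a factor of integrands over the whole plane,
    where the order of integration can be exchanged freely. *)
Definition pos_ind (s : R) : R := \1_[set x : R | 0 < x] s.

Lemma pos_ind1 s : 0 < s -> pos_ind s = 1.
Proof. by move=> s0; rewrite /pos_ind indicE mem_set. Qed.

Lemma pos_ind0 s : ~~ (0 < s) -> pos_ind s = 0.
Proof. by move=> s0; rewrite /pos_ind indicE memNset//; exact/negP. Qed.

Lemma pos_ind_ge0 s : 0 <= pos_ind s.
Proof. by rewrite /pos_ind indicE. Qed.

Lemma measurable_pos_ind : measurable_fun setT pos_ind.
Proof. by apply: measurable_indic; exact: measurable_positive_halfline. Qed.

Lemma integral_positive_halfline (f : R -> \bar R) :
  (\int[mu]_(s in [set s : R | (0 < s)%R]) f s =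
   \int[mu]_s ((pos_ind s)%:E * f s))%E.
Proof.
rewrite integral_mkcond; apply: eq_integral => s _; rewrite patchE.
have [s0|s0] := boolP (0 < s); first by rewrite mem_set// pos_ind1// mul1e.
by rewrite memNset ?pos_ind0 ?mul0e//; exact/negP.
Qed.

(** The marginal of one datum x0 is the integral of p over the half-line on the
    side of x0 with respect to du / |u|, by the substitution u = x0 / s; so if it
    does not vanish then neither does the Lebesgue integral. *)
Lemma haar_integral_scale_gt0 (p : R -> R) (x0 : R) : x0 != 0 ->
  measurable_fun setT p -> (forall x, 0 <= p x) ->
  (0 < \int[mu]_(s in [set s : R | (0 < s)%R]) (s^-1 * p (x0 / s))%:E)%E ->
  (0 < \int[mu]_u (p u * pos_ind (x0 * u))%:E)%E.
Proof.
move=> x00 mp p0 int0.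
pose G (u : R) := (p u * pos_ind (x0 * u))%:E.
have mG : measurable_fun setT G.
  apply/measurable_EFinP; apply: measurable_funM => //.
  exact: measurableT_comp measurable_pos_ind (mulrl_measurable x0).
have G0 u : (0 <= G u)%E by rewrite lee_fin mulr_ge0// pos_ind_ge0.
rewrite lt0e; apply/andP; split; last first.
  by apply: integral_ge0 => u _; exact: G0.
apply/negP => /eqP G_eq0.
have mw : measurable_fun setT (fun u : R => (`|u|^-1)%:E).
  apply/measurable_EFinP; apply: (measurableT_comp (@measurable_fun_inv R)).
  exact: normr_measurable.
have Gw_eq0 : (\int[mu]_u (G u * (`|u|^-1)%:E) = 0)%E.
  apply: (@ge0_integral_eq0_support _ _ mu setT G) => //.
  - exact: emeasurable_funM.
  - by move=> u _; rewrite mule_ge0// lee_fin invr_ge0.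
  - by move=> u _ ->; rewrite mul0e.
move: int0; rewrite integral_positive_halfline.
have -> : (\int[mu]_s ((pos_ind s)%:E * (s^-1 * p (x0 / s))%:E) =
           \int[mu]_s (G (x0 * s^-1)%R * (`|s|^-1)%:E))%E.
  apply: eq_integral => s _; rewrite /G -!EFinM; congr EFin.
  have [s0|s0] := boolP (0 < s).
    rewrite mulrA -expr2 !pos_ind1//; last first.
      by rewrite mulr_gt0// ?invr_gt0// exprn_even_gt0.
    by rewrite gtr0_norm//; ring.
  rewrite mulrA -expr2 !pos_ind0 ?mulr0 ?mul0r//.
  by rewrite pmulr_rgt0 ?invr_gt0// exprn_even_gt0.
rewrite (@ge0_integral_haar_inv R (fun s => G (x0 * s)%R))//; last first.
  exact: measurableT_comp mG (mulrl_measurable x0).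
by rewrite ge0_integral_haar_dilation// Gw_eq0 ltxx.
Qed.

(** This is the substitution u = (x2 - m) / s, v = (x1 - m) / s, for which
    (x2 - x1) (u - v) > 0 characterizes s > 0.  It is carried out one variable at
    a time: from m to v at fixed s, from s to t = 1 / s, and from t to
    u = v + (x2 - x1) t at fixed v. *)
Lemma integral_location_scale_pair (p q : R -> R) (x1 x2 : R) :
  x1 != x2 -> measurable_fun setT p -> measurable_fun setT q ->
  (forall x, 0 <= p x) -> (forall x, 0 <= q x) ->
  (\int[mu]_m \int[mu]_s
     (pos_ind s * (s ^- 3 * (p ((x1 - m) / s) * q ((x2 - m) / s))))%:E =
   `|x2 - x1|^-1%:E *
     \int[mu]_v \int[mu]_u (p v * q u * pos_ind ((x2 - x1) * (u - v)))%:E)%E.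
Proof.
move=> x12 mp mq p0 q0; set d := x2 - x1.
have d0 : d != 0 by rewrite subr_eq0 eq_sym.
have mi := @measurable_fun_inv R.
have mpi := measurable_pos_ind.
have m1 : measurable_fun setT (@fst R R) by exact: measurable_fst.
have m2 : measurable_fun setT (@snd R R) by exact: measurable_snd.
pose A (z : R * R) : \bar R := (pos_ind z.2 *
  (z.2 ^- 3 * (p ((x1 - z.1) / z.2) * q ((x2 - z.1) / z.2))))%:E.
have mA : measurable_fun setT A.
  have mc (x : R) : measurable_fun setT (fun z : R * R => (x - z.1) / z.2).
    by apply: measurable_funM; [exact: measurable_funB|exact: measurableT_comp mi m2].
  apply/measurable_EFinP; apply: measurable_funM; first exact: measurableT_comp mpi m2.
  apply: measurable_funM.
    by apply: measurableT_comp mi _; exact: measurable_funX.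
  by apply: measurable_funM; [exact: measurableT_comp mp (mc _)|exact: measurableT_comp mq (mc _)].
pose B (z : R * R) : \bar R := (pos_ind z.1 * (p z.2 * q (z.2 + d * z.1)))%:E.
have mB : measurable_fun setT B.
  apply/measurable_EFinP; apply: measurable_funM; first exact: measurableT_comp mpi m1.
  apply: measurable_funM; first exact: measurableT_comp mp m2.
  apply: measurableT_comp mq _; apply: measurable_funD => //.
  exact: measurable_funM.
have A0 z : (0 <= A z)%E.
  rewrite lee_fin /A; have [s0|s0] := boolP (0 < z.2); last by rewrite pos_ind0// mul0r.
  by rewrite !mulr_ge0 ?pos_ind_ge0 ?invr_ge0 ?exprn_ge0// ltW.
have B0 z : (0 <= B z)%E by rewrite lee_fin !mulr_ge0 ?pos_ind_ge0.
rewrite -[LHS]/(\int[mu]_m \int[mu]_s A (m, s))%E.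
transitivity (\int[mu]_s \int[mu]_m A (m, s))%E; first exact: fubini_tonelli.
pose H (t : R) : \bar R := (\int[mu]_v B (t, v))%E.
(* s = 1 / t *)
transitivity (\int[mu]_s (H (s^-1)%R * (s ^- 2)%:E))%E.
  apply: eq_integral => s _; rewrite /H /A /B/=.
  have [s0|s0] := boolP (0 < s); last first.
    rewrite !integral0_eq ?mul0e// => v _; rewrite pos_ind0 ?mul0r// invr_gt0//.
  have si0 : - s^-1 != 0 by rewrite oppr_eq0 invr_eq0 gt_eqF.
  pose F (v : R) : \bar R := (s ^- 3 * (p v * q (v + d / s)))%:E.
  have mpq : measurable_fun setT (fun v : R => p v * q (v + d / s)).
    apply: measurable_funM => //; apply: measurableT_comp mq _.
    exact: measurable_funD.
  have mF : measurable_fun setT F by apply/measurable_EFinP; exact: measurable_funM.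
  have F0 v : setT v -> (0 <= F v)%E.
    by move=> _; rewrite lee_fin !mulr_ge0// ?invr_ge0 ?exprn_ge0// ltW.
  have := ge0_integral_affine (x1 / s) si0 measurableT mF F0.
  rewrite preimage_setT normrN gtr0_norm ?invr_gt0// invrK => aff.
  transitivity (\int[mu]_m F (- s^-1 * m + x1 / s)%R)%E.
    apply: eq_integral => m _; rewrite /F pos_ind1// mul1r.
    have -> : - s^-1 * m + x1 / s = (x1 - m) / s by ring.
    by have -> : (x1 - m) / s + d / s = (x2 - m) / s by rewrite /d; ring.
  pose P (v : R) : \bar R := (p v * q (v + d / s))%:E.
  have mP : measurable_fun setT P by apply/measurable_EFinP.
  have P0 v : setT v -> (0 <= P v)%E by move=> _; rewrite lee_fin mulr_ge0.
  transitivity (s%:E * ((s ^- 3)%:E * \int[mu]_v P v))%E.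
    rewrite aff; congr (_ * _)%E.
    rewrite -ge0_integralZl//.
    by rewrite lee_fin invr_ge0 exprn_ge0// ltW.
  have -> : (\int[mu]_v (pos_ind s^-1 * (p v * q (v + d * s^-1)))%:E =
             \int[mu]_v P v)%E.
    by apply: eq_integral => v _; rewrite pos_ind1 ?invr_gt0// mul1r.
  rewrite muleA -EFinM muleC; congr (_ * _%:E)%E.
  by field; rewrite gt_eqF.
rewrite ge0_integral_inv//; last 2 first.
- exact: (measurable_fun_fubini_tonelli_F (m2 := mu) B mB B0).
- by move=> t; apply: integral_ge0 => v _; exact: B0.
transitivity (\int[mu]_v \int[mu]_t B (t, v))%E.
  exact: fubini_tonelli.
rewrite -ge0_integralZl//; last 2 first.
- have mC : measurable_fun setT (fun z : R * R =>
      (p z.1 * q z.2 * pos_ind (d * (z.2 - z.1)))%:E).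
    apply/measurable_EFinP; apply: measurable_funM.
      by apply: measurable_funM; [exact: measurableT_comp mp m1|exact: measurableT_comp mq m2].
    apply: measurableT_comp mpi _; apply: measurable_funM => //.
    exact: measurable_funB.
  apply: (measurable_fun_fubini_tonelli_F (m2 := mu) _ mC) => z.
  by rewrite lee_fin !mulr_ge0// pos_ind_ge0.
- by move=> v _; apply: integral_ge0 => u _; rewrite lee_fin !mulr_ge0// pos_ind_ge0.
apply: eq_integral => v _; rewrite /B/=.
pose G (u : R) : \bar R := (p v * q u * pos_ind (d * (u - v)))%:E.
have mG : measurable_fun setT G.
  apply/measurable_EFinP; apply: measurable_funM; first exact: measurable_funM.
  apply: measurableT_comp mpi _; apply: measurable_funM => //.
  exact: measurable_funB.
have G0 u : setT u -> (0 <= G u)%E by rewrite lee_fin !mulr_ge0// pos_ind_ge0.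
have := ge0_integral_affine v d0 measurableT mG G0.
rewrite preimage_setT => <-.
apply: eq_integral => t _; rewrite /G addrK; congr EFin.
have -> : pos_ind (d * (d * t)) = pos_ind t.
  have d2 : 0 < d ^+ 2 by rewrite exprn_even_gt0.
  rewrite mulrA -expr2; have [t0|t0] := boolP (0 < t).
    by rewrite !pos_ind1// pmulr_rgt0.
  by rewrite !pos_ind0// pmulr_rgt0.
by rewrite (addrC v) mulrC.
Qed.

End Integrals.

(** * Locations at which the marginals are positive and finite *)

Section GoodLocation.
Variable R : realType.
Notation mu := (@lebesgue_measure R).

(** Exchanging u and v exchanges the half-planes d (u - v) > 0 and
    d (u - v) < 0, and the diagonal is negligible; so each half-plane carries
    half of the square of the integral of e. *)
Lemma half_square_gt0 (e : R -> R) (d : R) : d != 0 ->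
  measurable_fun setT e -> (forall x, 0 <= e x) ->
  (0 < \int[mu]_u (e u)%:E)%E ->
  (0 < \int[mu]_v \int[mu]_u (e v * e u * pos_ind (d * (u - v)))%:E)%E.
Proof.
move=> d0 me e0 int0.
have mpi := @measurable_pos_ind R.
have m1 : measurable_fun setT (@fst R R) by exact: measurable_fst.
have m2 : measurable_fun setT (@snd R R) by exact: measurable_snd.
pose A (z : R * R) : \bar R := (e z.1 * e z.2 * pos_ind (d * (z.2 - z.1)))%:E.
pose B (z : R * R) : \bar R := (e z.1 * e z.2 * pos_ind (d * (z.1 - z.2)))%:E.
have mee : measurable_fun setT (fun z : R * R => e z.1 * e z.2).
  by apply: measurable_funM; [exact: measurableT_comp me m1|exact: measurableT_comp me m2].
have mA : measurable_fun setT A.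
  apply/measurable_EFinP; apply: measurable_funM => //.
  apply: measurableT_comp mpi _; apply: measurable_funM => //.
  exact: measurable_funB.
have mB : measurable_fun setT B.
  apply/measurable_EFinP; apply: measurable_funM => //.
  apply: measurableT_comp mpi _; apply: measurable_funM => //.
  exact: measurable_funB.
have A0 z : (0 <= A z)%E by rewrite lee_fin !mulr_ge0// pos_ind_ge0.
have B0 z : (0 <= B z)%E by rewrite lee_fin !mulr_ge0// pos_ind_ge0.
have mAF := measurable_fun_fubini_tonelli_F (m2 := mu) A mA A0.
have mBF := measurable_fun_fubini_tonelli_F (m2 := mu) B mB B0.
rewrite -[X in (_ < X)%E]/(\int[mu]_v \int[mu]_u A (v, u))%E.
rewrite lt0e; apply/andP; split; last first.
  by apply: integral_ge0 => v _; apply: integral_ge0 => u _; exact: A0.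
apply/negP => /eqP intA.
have intB : (\int[mu]_v \int[mu]_u B (v, u) = 0)%E.
  transitivity (\int[mu]_u \int[mu]_v B (v, u))%E; first exact: fubini_tonelli.
  rewrite -intA; apply: eq_integral => v _; apply: eq_integral => u _.
  by rewrite /A /B/= (mulrC (e u)).
have : (\int[mu]_v ((e v)%:E * \int[mu]_u (e u)%:E) = 0)%E.
  transitivity (\int[mu]_v (\int[mu]_u A (v, u) + \int[mu]_u B (v, u)))%E.
    apply: eq_integral => v _.
    have mAv : measurable_fun setT (fun u => A (v, u)) by exact: measurableT_comp mA _.
    have mBv : measurable_fun setT (fun u => B (v, u)) by exact: measurableT_comp mB _.
    rewrite -ge0_integralD// -ge0_integralZl//; last 3 first.
    - exact/measurable_EFinP.
    - by move=> u _; rewrite lee_fin.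
    - by rewrite lee_fin.
    apply: ge0_ae_eq_integral => //.
    - by apply: emeasurable_funM => //; exact/measurable_EFinP.
    - exact: emeasurable_funD.
    - by move=> u _; rewrite mule_ge0// lee_fin.
    - by move=> u _; rewrite adde_ge0.
    exists [set v]; split => //; first exact: lebesgue_measure_set1.
    move=> u /=; apply: contra_notP => /eqP uv _.
    rewrite /A /B/= -!EFinM -EFinD -mulrDr.
    suff -> : pos_ind (d * (u - v)) + pos_ind (d * (v - u)) = 1 by rewrite mulr1.
    have : d * (u - v) != 0 by rewrite mulf_neq0// subr_eq0.
    have -> : d * (v - u) = - (d * (u - v)) by ring.
    case: (ltrgt0P (d * (u - v))) => // h _.
      by rewrite pos_ind1// pos_ind0 ?addr0// oppr_gt0 -leNgt ltW.
    by rewrite pos_ind0 ?add0r ?pos_ind1// ?oppr_gt0// -leNgt ltW.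
  rewrite ge0_integralD//; last 2 first.
  - by move=> v _; exact: integral_ge0.
  - by move=> v _; exact: integral_ge0.
  by rewrite intB adde0; exact: intA.
rewrite ge0_integralZr//; last 3 first.
- exact/measurable_EFinP.
- by move=> v _; rewrite lee_fin.
- exact: ltW.
by move=> /eqP; rewrite mule_eq0 orbb => /eqP h; rewrite h ltxx in int0.
Qed.

Lemma half_square_lty (e : R -> R) (d : R) : is_density (@leb1 R) setT e ->
  (\int[mu]_v \int[mu]_u (e v * e u * pos_ind (d * (u - v)))%:E < +oo)%E.
Proof.
move=> [me e0 e1].
have mpi := @measurable_pos_ind R.
have m1 : measurable_fun setT (@fst R R) by exact: measurable_fst.
have m2 : measurable_fun setT (@snd R R) by exact: measurable_snd.
have e0' x : 0 <= e x by exact: e0.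
pose A (z : R * R) : \bar R := (e z.1 * e z.2 * pos_ind (d * (z.2 - z.1)))%:E.
have mA : measurable_fun setT A.
  apply/measurable_EFinP; apply: measurable_funM.
    by apply: measurable_funM; [exact: measurableT_comp me m1|exact: measurableT_comp me m2].
  apply: measurableT_comp mpi _; apply: measurable_funM => //.
  exact: measurable_funB.
have A0 z : (0 <= A z)%E by rewrite lee_fin !mulr_ge0// pos_ind_ge0.
have mAF := measurable_fun_fubini_tonelli_F (m2 := mu) A mA A0.
apply: (@le_lt_trans _ _ (\int[mu]_v (e v)%:E)%E); last by rewrite e1 ltry.
apply: ge0_le_integral => //.
- by move=> v _; apply: integral_ge0 => u _; exact: (A0 (v, u)).
- exact/measurable_EFinP.
move=> v _; rewrite -[leRHS]mule1 -e1 -ge0_integralZl//; last 2 first.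
- exact/measurable_EFinP.
- by rewrite lee_fin.
apply: ge0_le_integral => //.
- by move=> u _; exact: (A0 (v, u)).
- have mAv : measurable_fun setT (fun u => A (v, u)) by exact: measurableT_comp mA _.
  exact: mAv.
- by apply: emeasurable_funM => //; exact/measurable_EFinP.
- move=> u _; rewrite -EFinM lee_fin ler_piMr ?mulr_ge0//.
  by rewrite /pos_ind indicE; case: (_ \in _).
Qed.

(** Up to a constant factor, this is the product of the inverse density
    of s given m and x1 with the direct density of x2. *)
Definition pair_weight (p : R -> R) (x1 x2 m s : R) : R :=
  s ^- 3 * (p ((x1 - m) / s) * p ((x2 - m) / s)).

Lemma measurable_pair_weight (p : R -> R) (x1 x2 : R) :
  measurable_fun setT p ->
  measurable_fun setT (fun z : R * R => pos_ind z.2 * pair_weight p x1 x2 z.1 z.2).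
Proof.
move=> mp; have mi := @measurable_fun_inv R.
have mpi := @measurable_pos_ind R.
have m1 : measurable_fun setT (@fst R R) by exact: measurable_fst.
have m2 : measurable_fun setT (@snd R R) by exact: measurable_snd.
have mc (x : R) : measurable_fun setT (fun z : R * R => (x - z.1) / z.2).
  by apply: measurable_funM; [exact: measurable_funB|exact: measurableT_comp mi m2].
apply: measurable_funM; first exact: measurableT_comp mpi m2.
apply: measurable_funM.
  by apply: measurableT_comp mi _; exact: measurable_funX.
by apply: measurable_funM; [exact: measurableT_comp mp (mc _)|exact: measurableT_comp mp (mc _)].
Qed.

(** The integral over m of the weights of p is finite, so these are finite for
    almost every m.  The weights of the restriction of p to the side of x0 have
    a positive integral over m, hence are positive on a non-negligible set of m;
    where they are positive, x1 - m is on the side of x0. *)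
Lemma exists_location_with_finite_weights (p : R -> R) (x0 x1 x2 : R) (n : R -> \bar R) :
  is_density (@leb1 R) setT p ->
  (0 < \int[mu]_u (p u * pos_ind (x0 * u))%:E)%E -> x1 != x2 ->
  {ae mu, forall m, (n m < +oo)%E} ->
  exists m, [/\ 0 < x0 * (x1 - m), (n m < +oo)%E &
    (0 < \int[mu]_(s in [set s : R | (0 < s)%R]) (pair_weight p x1 x2 m s)%:E
       < +oo)%E].
Proof.
move=> dp pE x12 nfin; have [mp p0 p1] := dp.
have p0' x : 0 <= p x by exact: p0.
(* p restricted to the side of x0 *)
pose e (u : R) : R := p u * pos_ind (x0 * u).
have me : measurable_fun setT e.
  apply: measurable_funM => //.
  exact: measurableT_comp (@measurable_pos_ind R) (mulrl_measurable x0).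
have e0 x : 0 <= e x by rewrite mulr_ge0// pos_ind_ge0.
have d0 : x2 - x1 != 0 by rewrite subr_eq0 eq_sym.
pose A (q : R -> R) (z : R * R) : \bar R :=
  (pos_ind z.2 * pair_weight q x1 x2 z.1 z.2)%:E.
have A0 (q : R -> R) : (forall x, 0 <= q x) -> forall z, (0 <= A q z)%E.
  move=> q0 z; rewrite lee_fin; have [s0|s0] := boolP (0 < z.2); last by rewrite pos_ind0// mul0r.
  by rewrite !mulr_ge0 ?pos_ind_ge0 ?invr_ge0 ?exprn_ge0// ltW.
have mA (q : R -> R) : measurable_fun setT q -> measurable_fun setT (A q).
  by move=> mq; apply/measurable_EFinP; exact: measurable_pair_weight.
pose M (q : R -> R) (m : R) := (\int[mu]_s A q (m, s))%E.
have ME m : (\int[mu]_(s in [set s : R | (0 < s)%R]) (pair_weight p x1 x2 m s)%:E)%E = M p m.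
  by rewrite integral_positive_halfline; apply: eq_integral => s _; rewrite -EFinM.
have M0 (q : R -> R) m : (forall x, 0 <= q x) -> (0 <= M q m)%E.
  by move=> q0; apply: integral_ge0 => s _; exact: A0.
have mM (q : R -> R) : measurable_fun setT q -> (forall x, 0 <= q x) -> measurable_fun setT (M q).
  by move=> mq q0; exact: (measurable_fun_fubini_tonelli_F (m2 := mu) _ (mA _ mq) (A0 _ q0)).
have Mp_fin : {ae mu, forall m, (M p m < +oo)%E}.
  apply: ge0_integral_lty_ae; [exact: mM|by move=> m; exact: M0|].
  rewrite [X in (X < _)%E](integral_location_scale_pair x12 mp mp p0' p0').
  by rewrite lte_mul_pinfty// ?half_square_lty// lee_fin invr_ge0.
have Me_gt0 : (0 < \int[mu]_m M e m)%E.
  rewrite [X in (_ < X)%E](integral_location_scale_pair x12 me me e0 e0).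
  by rewrite mule_gt0 ?half_square_gt0// lte_fin invr_gt0 normr_gt0.
apply: contrapT => nex.
move: Me_gt0; suff -> : (\int[mu]_m M e m = 0)%E by rewrite ltxx.
rewrite -[RHS](integral0 mu setT); apply: ge0_ae_eq_integral => //.
- exact: mM.
- by move=> m _; exact: M0.
move: Mp_fin nfin; apply: (@filterS2 _ _ (ae_filter_ringOfSetsType mu)) => m Mm nm _ /=.
apply: contrapT => /eqP Mem.
apply: nex; exists m; split => //.
- apply: contrapT => /negP x0m; move/eqP: Mem; apply.
  apply: integral0_eq => s _; rewrite /A/= /pair_weight /e.
  have [s0|s0] := boolP (0 < s); last by rewrite pos_ind0// mul0r.
  rewrite (@pos_ind0 _ (x0 * ((x1 - m) / s))) ?(mulr0, mul0r)//.
  by rewrite mulrA pmulr_lgt0 ?invr_gt0.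
- rewrite ME Mm andbT lt0e M0// andbT; apply: contra_neq Mem => Mp0.
  apply: (@ge0_integral_eq0_support _ _ _ mu setT (fun s => A p (m, s))) => //.
  + exact: measurableT_comp (mA _ mp) _.
  + exact: measurableT_comp (mA _ me) _.
  + by move=> s _; exact: A0.
  + by move=> s _; exact: A0.
  + move=> s _; rewrite /A/= /pair_weight /e => -[h].
    have -> : forall a b c d f g : R, a * (b * (c * d * (f * g))) =
        a * (b * (c * f)) * (d * g) by move=> *; ring.
    by rewrite h mul0r.
Qed.

End GoodLocation.

(** * Location-scale families *)

Section LocationScale.
Variables (R : realType) (Phi phi : R -> R) (I : parametric_family R R (R * R)).
Hypothesis hI : is_location_scale Phi phi I.
Notation mu := (@lebesgue_measure R).

Lemma location_scale_density : is_density (@leb1 R) setT phi.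
Proof. by have [[]] := hI. Qed.

Lemma location_scale_params : params I = [set theta | 0 < theta.2].
Proof. by have [] := hI. Qed.

Lemma location_scale_densE m s x : 0 < s ->
  dens I (m, s) x = s^-1 * phi ((x - m) / s).
Proof. by have [_ _ _] := hI; exact. Qed.

Lemma location_scale_fix1 m : scale_family phi m (fix1 I m).
Proof.
split; first by rewrite /fix1/= location_scale_params.
by move=> s x s0; exact: location_scale_densE.
Qed.

Lemma open_half_plane : open [set theta : R * R | 0 < theta.2].
Proof.
have -> : [set theta : R * R | 0 < theta.2] = snd @^-1` [set x : R | 0 < x] by [].
by apply: open_comp; [move=> x _; exact: cvg_snd|exact: open_gt].
Qed.

Lemma measurable_half_plane : measurable [set theta : R * R | 0 < theta.2].
Proof.
have -> : [set theta : R * R | 0 < theta.2] = setT `*` [set x : R | 0 < x].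
  by apply/seteqP; split => x /=; [split|case].
by apply: measurableX => //; exact: measurable_positive_halfline.
Qed.

Lemma location_scale_dens_density theta : params I theta ->
  is_density (@leb1 R) setT (dens I theta).
Proof.
case: theta => m s; rewrite location_scale_params => s0.
exact: (scale_family_dens_density location_scale_density (location_scale_fix1 m) s0).
Qed.

Lemma location_scale_direct : is_direct (@leb1 R) I.
Proof.
split; last exact: location_scale_dens_density.
rewrite location_scale_params; exact: open_half_plane.
Qed.

Lemma iid_direct : is_direct (@leb2 R) (iid I).
Proof.
split; first by have [] := location_scale_direct.
move=> theta /location_scale_dens_density [mp p0 p1].
have m1 : measurable_fun setT (@fst R R) by exact: measurable_fst.
have m2 : measurable_fun setT (@snd R R) by exact: measurable_snd.
have p0' x : 0 <= dens I theta x by exact: p0.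
have mpp : measurable_fun setT (fun x : R * R => dens I theta x.1 * dens I theta x.2).
  by apply: measurable_funM; [exact: measurableT_comp mp m1|exact: measurableT_comp mp m2].
split => //; first by move=> x _; rewrite mulr_ge0.
rewrite (fubini_tonelli1 (m1 := mu) (m2 := mu)); first last.
- by move=> x; rewrite lee_fin mulr_ge0.
- exact/measurable_EFinP.
rewrite -[RHS]p1; apply: eq_integral => x _; rewrite /fubini_F/=.
under eq_integral do rewrite EFinM.
rewrite ge0_integralZl//; last 2 first.
- exact/measurable_EFinP.
- by rewrite lee_fin.
by rewrite [X in (_ * X)%E]p1 mule1.
Qed.

Lemma location_scale_affine a b : 0 < a ->
  transformed1 setT (fun x => a * x + b)
    (separate (fun m => a * m + b) (fun s => a * s + 0)) I I.
Proof.
move=> a0; have an0 : a != 0 by rewrite gt_eqF.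
split; [exact: openT|exact: regular1_affine|split].
- rewrite location_scale_params; apply/seteqP; split => -[m s] /= s0.
    exists ((m - b) / a, s / a) => /=; first exact: divr_gt0.
    by rewrite /separate/=; congr pair; field.
  by case: s0 => -[m' s'] /= s'0 [_ <-]; rewrite addr0 mulr_gt0.
- by move=> theta /location_scale_dens_density [].
- move=> [m s] x; rewrite location_scale_params => /= s0 _.
  rewrite derive1_affine /separate/= addr0 !location_scale_densE ?mulr_gt0// gtr0_norm//.
  have -> : (a * x + b - (a * m + b)) / (a * s) = (x - m) / s.
    by field; rewrite an0 gt_eqF.
  by field; rewrite an0 gt_eqF.
Qed.

(** The extension of g by 0 makes Tonelli's theorem applicable. *)
Lemma half_plane_density (g : R * R -> R) :
  is_density (@leb2 R) [set theta | 0 < theta.2] g ->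
  exists G : R * R -> \bar R,
    [/\ measurable_fun setT G, (forall z, (0 <= G z)%E),
      (forall z, 0 < z.2 -> G z = (g z)%:E), (forall z, ~~ (0 < z.2) -> G z = 0%E) &
      (\int[@leb2 R]_z G z = 1)%E].
Proof.
move=> [mg g0 g1].
exists ((fun z => (g z)%:E) \_ [set theta | 0 < theta.2]); split.
- have := (measurable_restrict (fun z => (g z)%:E) measurable_half_plane measurableT).1.
  by rewrite setTI; apply; exact/measurable_EFinP.
- by move=> z; rewrite patchE; case: ifPn => //; rewrite inE => z0; rewrite lee_fin g0.
- by move=> z z0; rewrite patchE mem_set.
- by move=> z /negP z0; rewrite patchE memNset.
- by rewrite -integral_mkcond.
Qed.

End LocationScale.

(** * The two data of a joint inverse distribution *)

Section Distinct.
Variables (R : realType).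
Notation mu := (@lebesgue_measure R).

(** If x1 = x2, the dilations about this point multiply the marginal density of
    s by a character. *)
Lemma joint_inverse_distinct_data (p w : R -> R) (c x1 x2 : R) (g : R * R -> R) :
  is_density (@leb2 R) [set theta | 0 < theta.2] g ->
  (forall a, 0 < a -> 0 < w a / w 1) ->
  (forall a b, 0 < a -> 0 < b -> w (a * b) * w 1 = w a * w b) ->
  (forall m s, 0 < s ->
    g (m, s) = w s * c * (s^-1 * p ((x1 - m) / s) * (s^-1 * p ((x2 - m) / s)))) ->
  x1 != x2.
Proof.
move=> dg w0 wM gE; apply/eqP => x12.
have [G [mG G0 GE Gout G1]] := half_plane_density dg.
pose q (s : R) : \bar R := (\int[mu]_m G (m, s))%E.
have mq : measurable_fun setT q := measurable_fun_fubini_tonelli_G (m1 := mu) G mG G0.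
have q0 s : (0 <= q s)%E by apply: integral_ge0 => m _; exact: G0.
have mpos := @measurable_positive_halfline R.
(* g contributes w a / w 1 and a^-2, the substitution in m contributes a *)
apply: (@dilation_equivariant_not_density R q (fun a => a^-1 * (w a / w 1))).
- exact: measurable_funTS.
- by move=> s _; exact: q0.
- by move=> a a0; rewrite mulr_ge0 ?invr_ge0 ?ltW// w0.
- move=> a s a0 s0; rewrite /q.
  have an0 : a != 0 by rewrite gt_eqF.
  have sn0 : s != 0 by rewrite gt_eqF.
  have wn0 : w 1 != 0.
    by apply: contraTneq (w0 1 ltr01) => ->; rewrite invr0 mulr0 ltxx.
  have mGs t : measurable_fun setT (fun m : R => G (m, t)).
    by apply: measurableT_comp mG _.
  have := ge0_integral_affine (x1 - a * x1) an0 measurableT (mGs (a * s)) (fun m _ => G0 (m, a * s)).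
  rewrite preimage_setT gtr0_norm// => aff.
  transitivity (a%:E * ((a^-1)%:E * \int[mu]_m G (m, (a * s)%R)))%E.
    by rewrite muleA -EFinM mulfV// mul1e.
  rewrite -aff.
  have -> : (\int[mu]_m G ((a * m + (x1 - a * x1))%R, (a * s)%R) =
             \int[mu]_m ((a ^- 2 * (w a / w 1))%:E * G (m, s)))%E.
    apply: eq_integral => m _; rewrite !GE ?mulr_gt0// -EFinM; congr EFin.
    rewrite !gE ?mulr_gt0// -x12.
    have -> : (x1 - (a * m + (x1 - a * x1))) / (a * s) = (x1 - m) / s.
      by field; rewrite an0 sn0.
    have -> : w (a * s) = w a * w s / w 1 by rewrite -wM// mulfK.
    by field; rewrite an0 sn0 wn0.
  rewrite ge0_integralZl//; last 2 first.
    exact: mGs.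
    by rewrite lee_fin mulr_ge0// ?invr_ge0 ?sqr_ge0// ltW// w0.
  by rewrite muleA -EFinM; congr (_%:E * _)%E; field; rewrite an0 wn0.
- rewrite integral_positive_halfline -G1.
  rewrite (fubini_tonelli2 (m1 := mu) (m2 := mu))//.
  apply: eq_integral => s _; rewrite /q /fubini_G.
  have [s0|s0] := boolP (0 < s); first by rewrite pos_ind1// mul1e.
  by rewrite pos_ind0// mul0e integral0_eq// => m _; exact: Gout.
Qed.

End Distinct.

(** * Consistency factors of location-scale families *)

Section LocationScaleInference.
Variables (R : realType) (T : inverse_assignment R).
Hypothesis hT : obeys_inverse_rules T.
Variables (Phi phi : R -> R) (I : parametric_family R R (R * R)).
Hypothesis hI : is_location_scale Phi phi I.
Notation mu := (@lebesgue_measure R).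

Let IP : params I = [set theta | 0 < theta.2] := location_scale_params hI.
Let dI := location_scale_direct hI.
Let dphi := location_scale_density hI.

Lemma consistency_factor_neq0 (X P : Type) (K : parametric_family R X P) inv zeta t :
  consistency_factor K inv zeta -> params K t -> zeta t != 0.
Proof.
by move=> [_ [] zsgn _] Kt; have := zsgn _ Kt => h; rewrite ?(gt_eqF h) ?(lt_eqF h).
Qed.

Lemma regular_separate_affine (D : set (R * R)) (a b a' b' : R) :
  a != 0 -> a' != 0 ->
  regular_separate D (fun m => a * m + b) (fun s => a' * s + b').
Proof. by move=> a0 a0'; split; exact: regular1_affine. Qed.

Lemma cfactor_given2_location zeta1 : cfactor_given2 T I zeta1 ->
  eq_up_to_given2 (params I) zeta1 (fun=> 1).
Proof.
move=> h1; have [_ _ _ _ [inv _ _]] := hT.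
have z1 (theta : R * R) : 0 < theta.2 -> zeta1 theta != 0.
  case: theta => m s /= s0.
  have Is : params (fix2 I s) m by rewrite /= IP.
  exact: (consistency_factor_neq0 (h1 s (ex_intro _ m Is)) Is).
have [k k0 kinv] := inv I zeta1 dI h1.
have kn0 (theta : R * R) : 0 < theta.2 -> k theta.2 != 0 by move=> t0; apply: (k0 theta); rewrite IP.
have [||indep _] := @affine_semi_invariant R (fun theta => k theta.2 * zeta1 theta).
- by move=> theta t0; rewrite mulf_neq0 ?z1// kn0.
- move=> a b a0; have an0 : a != 0 by rewrite gt_eqF.
  have [chi chiP] := kinv _ _ _ _ (regular_separate_affine (params I) b 0 an0 an0)
    (location_scale_affine hI b a0).
  exists (chi / `|a|) => theta t0; have := chiP theta; rewrite IP => /(_ t0).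
  rewrite derive1_affine /separate/= addr0 => e.
  by rewrite mulrAC -e mulfK// normr_eq0.
exists (fun s => zeta1 (0, s)) => -[m s]; rewrite IP /= => s0; split; first exact: z1.
by rewrite mulr1; apply: (mulfI (kn0 (m, s) s0)); exact: (indep (m, s)).
Qed.

Lemma cfactor_given1_scale zeta2 : cfactor_given1 T I zeta2 ->
  forall m s, 0 < s -> zeta2 (m, 1) != 0 /\ zeta2 (m, s) = zeta2 (m, 1) * s^-1.
Proof.
move=> h2 m s s0.
have Im : params (fix1 I m) 1 by rewrite /= IP /= ltr01.
have [c c0 cE] := scale_family_consistency_factor hT dphi
  (location_scale_fix1 hI m) (h2 m (ex_intro _ 1 Im)).
by rewrite (cE 1 ltr01) invr1 mulr1 cE.
Qed.

Lemma cfactor_joint_affine zeta : cfactor_joint T I zeta ->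
  (forall theta : R * R, 0 < theta.2 -> zeta theta = zeta (0, theta.2)) /\
  (forall a b, 0 < a -> 0 < b ->
     zeta (0, a * b) * zeta (0, 1) = zeta (0, a) * zeta (0, b)).
Proof.
move=> h; have [_ _ _ _ [_ _ inv]] := hT.
apply: affine_semi_invariant.
  by move=> theta t0; apply: (consistency_factor_neq0 h); rewrite /= IP.
move=> a b a0; have an0 : a != 0 by rewrite gt_eqF.
have [chi chiP] := inv I zeta dI h _ _ _ _
  (regular_separate_affine (params I) b 0 an0 an0) (location_scale_affine hI b a0).
exists (chi / `|a * a|) => theta t0; have := chiP theta; rewrite IP => /(_ t0).
rewrite !derive1_affine /separate/= addr0 => e.
by rewrite mulrAC -e mulfK// normr_eq0 mulf_neq0.
Qed.

(** A datum x0 at which an inverse distribution given mu = 0 exists is mapped to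
    x by an affine map which takes 0 to m, as long as x - m has the sign of x0. *)
Lemma inverse_exists_on_side zeta2 : cfactor_given1 T I zeta2 ->
  exists x0 : R, (0 < \int[mu]_u (phi u * pos_ind (x0 * u))%:E)%E /\
    forall m x, 0 < x0 * (x - m) -> exists g, inv11 T (fix1 I m) x = Some g.
Proof.
move=> h2.
have I0 : params (fix1 I 0) 1 by rewrite /= IP /= ltr01.
have [[x0 ex0] _ _] := h2 0 (ex_intro _ 1 I0).
have sc0 := location_scale_fix1 hI 0.
have x00 : x0 != 0.
  apply: contraTneq ex0 => ->.
  by rewrite (scale_family_no_inverse_at_center hT dphi sc0).
have dK m := scale_family_direct dphi (location_scale_fix1 hI m).
exists x0; split.
- have [[ex _ _] _ _ _ _] := hT.
  move: ex0; case gE : (inv11 T (fix1 I 0) x0) => [g|//] _.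
  have [_] := ex _ _ _ (dK 0) gE.
  have [KP KE] := sc0; rewrite KP => int0.
  have [mp p0 _] := dphi.
  apply: haar_integral_scale_gt0 => //; first by move=> x; exact: p0.
  suff <- : (\int[@leb1 R]_(s in [set s : R | (0 < s)%R]) (dens (fix1 I 0) s x0)%:E =
    \int[mu]_(s in [set s : R | (0 < s)%R]) (s^-1 * phi (x0 / s))%:E)%E by [].
  by apply: eq_integral => s; rewrite inE => s0; rewrite KE// subr0.
- move=> m x x0x; have a0 : 0 < (x - m) / x0.
    have -> : (x - m) / x0 = x0 * (x - m) / x0 ^+ 2 by field.
    by rewrite divr_gt0// exprn_even_gt0.
  have [_ [trI _ _] _ _ _] := hT.
  have := trI _ _ _ _ _ (dK 0) (dK m) (regular1_affine _ 0 (lt0r_neq0 a0))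
    (scale_family_affine dphi a0 sc0 (location_scale_fix1 hI m)) x0 Logic.I.
  have -> : (x - m) / x0 * x0 + (m - (x - m) / x0 * 0) = x by field.
  move: ex0; case: (inv11 T (fix1 I 0) x0) => // g _.
  by case: (inv11 T (fix1 I m) x) => // g' _; exists g'.
Qed.

Lemma joint_inverse_exists zeta : cfactor_joint T I zeta ->
  exists x1 x2 eta g, [/\ inv22 T (iid I) (x1, x2) = Some g, eta != 0,
    is_density (@leb2 R) [set theta | 0 < theta.2] g &
    forall m s, 0 < s -> g (m, s) = zeta (m, s) * eta *
      (s^-1 * phi ((x1 - m) / s) * (s^-1 * phi ((x2 - m) / s)))].
Proof.
move=> [[[x1 x2] ex] _ [eta etaP]].
move: ex; case gE : (inv22 T (iid I) (x1, x2)) => [g|//] _.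
have [eta0 gz] := etaP _ _ gE.
exists x1, x2, (eta (x1, x2))^-1, g; split => //; first by rewrite invr_eq0.
  have [[_ _ ex] _ _ _ _] := hT.
  by have [+ _] := ex _ _ _ (iid_direct hI) gE; rewrite /= IP.
move=> m s s0; rewrite gz /= ?IP//.
by rewrite !(location_scale_densE hI).
Qed.

(** The joint inverse density at a location m is s * w(s) * pair_weight up to a
    constant, where w is the joint factor; dividing by its marginal must give the
    same density of s as Bayes' theorem, which is pair_weight up to a constant.
    So s * w(s) is constant where pair_weight does not vanish. *)
Lemma cfactor_joint_scale zeta2 zeta : cfactor_given1 T I zeta2 ->
  cfactor_joint T I zeta ->
  forall s, 0 < s -> zeta (0, s) = zeta (0, 1) * s^-1.
Proof.
move=> h2 h.
have [zE zM] := cfactor_joint_affine h.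
pose w s := zeta (0, s).
have w0 s : 0 < s -> 0 < w s / w 1.
  move=> s0; have Is : params (iid I) (0, s) by rewrite /= IP.
  have I1 : params (iid I) (0, 1) by rewrite /= IP /= ltr01.
  have [_ [] zsgn _] := h; have := zsgn _ Is; have := zsgn _ I1; rewrite -/(w s) -/(w 1).
    by move=> h0 h1; exact: divr_gt0.
  by move=> h0 h1; rewrite nmulr_lgt0// invr_lt0.
have wn0 s : 0 < s -> w s != 0.
  by move=> s0; apply: contraTneq (w0 s s0) => ->; rewrite mul0r ltxx.
have [x1 [x2 [eta [g [gE eta0 dg gz]]]]] := joint_inverse_exists h.
have gw m s : 0 < s -> g (m, s) = w s * eta *
    (s^-1 * phi ((x1 - m) / s) * (s^-1 * phi ((x2 - m) / s))).
  by move=> s0; rewrite gz// zE.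
have x12 : x1 != x2 := joint_inverse_distinct_data dg w0 zM gw.
have [x0 [massE exE]] := inverse_exists_on_side h2.
have [G [mG G0 GE Gout G1]] := half_plane_density dg.
pose n (m : R) : \bar R := (\int[mu]_s G (m, s))%E.
have nfin : {ae mu, forall m, (n m < +oo)%E}.
  apply: ge0_integral_lty_ae.
  - exact: (measurable_fun_fubini_tonelli_F (m2 := mu) G mG G0).
  - by move=> m; apply: integral_ge0 => s _; exact: G0.
  - have -> : (\int[mu]_m n m = \int[@leb2 R]_z G z)%E.
      by rewrite (fubini_tonelli1 (m1 := mu) (m2 := mu)).
    by rewrite G1 ltry.
have [m [mside nm /andP[M0 Mfin]]] := exists_location_with_finite_weights dphi massE x12 nfin.
have [mp p0 _] := dphi; have p0' x : 0 <= phi x by exact: p0.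
have mpos := @measurable_positive_halfline R.
pose pw := pair_weight phi x1 x2 m.
have pw0 s : 0 < s -> 0 <= pw s.
  by move=> s0; rewrite !mulr_ge0// invr_ge0 exprn_ge0// ltW.
have mpw : measurable_fun [set s : R | 0 < s] pw.
  have mpw' : measurable_fun setT (fun s : R => pos_ind s * pw s).
    exact: (measurableT_comp (measurable_pair_weight x1 x2 mp) (measurable_pair1 m)).
  apply: (eq_measurable_fun (fun s : R => pos_ind s * pw s)).
    by move=> s; rewrite inE => s0; rewrite pos_ind1// mul1r.
  exact: measurable_funTS.
have KP : params (fix1 I m) = [set s | 0 < s] by rewrite /= IP.
have nE : (\int[@leb1 R]_(s in [set s : R | (0 < s)%R]) (g (m, s))%:E)%E = n m.
  rewrite [LHS]integral_positive_halfline; apply: eq_integral => s _.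
  have [s0|s0] := boolP (0 < s); first by rewrite pos_ind1// mul1e GE.
  by rewrite pos_ind0// mul0e Gout.
have mg : measurable_fun [set s : R | 0 < s] (fun s => (g (m, s))%:E).
  apply: (eq_measurable_fun (fun s => G (m, s))).
    by move=> s; rewrite inE => s0; rewrite GE.
  apply: measurable_funTS; exact: (measurableT_comp mG (measurable_pair1 m)).
have g0 s : 0 < s -> 0 <= g (m, s) by move=> s0; have [_ + _] := dg; apply.
have pwE s : 0 < s -> g (m, s) = w s * s * eta * pw s.
  by move=> s0; rewrite gw// /pw /pair_weight; field; rewrite gt_eqF.
have mpwE : measurable_fun [set s : R | 0 < s] (fun s => (pw s)%:E).
  exact/measurable_EFinP.
have n0 : (0 < n m)%E.
  rewrite -nE lt0e; apply/andP; split; last by apply: integral_ge0 => s; exact: g0.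
  apply/negP => /eqP int0; move: M0.
  rewrite (@ge0_integral_eq0_support _ _ _ mu _ (fun s => (g (m, s))%:E)) ?ltxx//.
  move=> s s0 []; rewrite pwE//.
  have nz : w s * s * eta != 0 by rewrite !mulf_neq0 ?wn0// gt_eqF.
  by move/eqP; rewrite mulf_eq0 (negbTE nz)/= => /eqP pws; rewrite -/(pw s) pws.
have [[ex _ _] _ prod bayes _] := hT.
have [_ /(_ m)] := prod _ _ _ (iid_direct hI) gE.
have -> : params (fix1 (iid I) m) = [set s | 0 < s] by rewrite /= IP.
rewrite /= nE n0 nm => /(_ isT) [hh hhE hhP].
have [g1 g1E] := exE m x1 mside.
have scK := location_scale_fix1 hI m.
have dK := scale_family_direct dphi scK.
have Km : params (fix1 I m) 1 by rewrite KP /= ltr01.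
have [_ _ [eta1 /(_ _ _ g1E) [eta10 g1z]]] := h2 m (ex_intro _ 1 Km).
have [[_ g10 _] _] := ex _ _ _ dK g1E.
have [z20 _] := cfactor_given1_scale h2 m ltr01.
pose b := zeta2 (m, 1) / eta1 x1.
have b_neq0 : b != 0 by rewrite mulf_neq0// invr_eq0.
have g1pw s : 0 < s -> g1 s * dens (fix1 I m) s x2 = b * pw s.
  move=> s0; rewrite g1z ?KP// /= !(location_scale_densE hI)//.
  have [_ ->] := cfactor_given1_scale h2 m s0.
  by rewrite /b /pw /pair_weight; field; rewrite eta10 gt_eqF.
have b_gt0 : 0 < b.
  rewrite lt_def b_neq0/= leNgt; apply/negP => b_lt0.
  move: M0; rewrite integral0_eq ?ltxx// => s s0; congr EFin.
  apply/eqP; rewrite eq_le pw0// andbT -(nmulr_rge0 _ b_lt0) -g1pw//.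
  rewrite mulr_ge0 ?g10 ?KP//= (location_scale_densE hI)//.
  by rewrite mulr_ge0 ?invr_ge0 ?(ltW s0).
have := bayes _ _ _ _ dK hhE x1 x2 g1 (or_introl erefl) g1E.
rewrite KP /=; set M := (\int[_]_(t in _) _)%E.
have ME : M = (b%:E * \int[mu]_(s in [set s : R | (0 < s)%R]) (pw s)%:E)%E.
  rewrite -ge0_integralZl//; last by rewrite lee_fin ltW.
  by apply: eq_integral => s; rewrite inE => s0; rewrite g1pw// EFinM.
have -> : (0 < M < +oo)%E.
  by rewrite ME mule_gt0 ?lte_fin//= lte_mul_pinfty// lee_fin ltW.
have MF : fine M != 0.
  rewrite gt_eqF// fine_gt0// ME mule_gt0 ?lte_fin//=.
  by rewrite lte_mul_pinfty// lee_fin ltW.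
have nF : fine (n m) != 0 by rewrite gt_eqF// fine_gt0// n0.
move=> /(_ isT) hhB.
(* the set on which the two expressions for the inverse density determine w *)
pose S := [set s : R | 0 < s] `&` pw @^-1` (~` [set 0]).
have mS : measurable S by apply: mpw => //; exact: measurableC.
have S0 : mu S != 0%E.
  apply/eqP => muS; move: M0.
  rewrite (@ge0_integral_eq0_support _ _ _ mu _ (fun s => (\1_S s)%:E)) ?ltxx//.
  - exact/measurable_EFinP/measurable_indic.
  - move=> s s0 []; rewrite indicE => /eqP; rewrite pnatr_eq0 eqb0 => /negP sS.
    congr EFin; apply: contrapT => pws; apply: sS; rewrite inE; split => //.
  - by rewrite integral_indic// setIidl// => s [].
have w1 := wn0 1 ltr01.
have psi1 := @multiplicative_constant_on_positive_measure R (fun s => w s / w 1 * s) S.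
move=> s s0; have sn0 : s != 0 by rewrite gt_eqF.
rewrite -/(w s) -/(w 1); apply: (mulIf sn0); rewrite divfK//.
apply: (mulIf (invr_neq0 w1)); rewrite mulfV// mulrAC psi1//.
- move=> a c a0 c0; have -> : w (a * c) = w a * w c / w 1 by rewrite -zM// mulfK.
  by field.
- by move=> a a0; rewrite mulr_gt0// w0.
- by move=> a [].
- have const a : S a -> w a * a = b / fine M * fine (n m) / eta.
    move=> [a0 /eqP pwa]; have := hhB a a0; rewrite hhP// g1pw// pwE// => e.
    have e' : w a * a * eta * pw a = b * pw a / fine M * fine (n m) by rewrite -e divfK.
    by apply: (mulIf eta0); rewrite divfK//; apply: (mulIf pwa); rewrite e'; field.
  move=> a c Sa Sc; have e t : w t / w 1 * t = w t * t / w 1 by rewrite mulrAC.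
  by rewrite !e (const a Sa) (const c Sc).
Qed.

End LocationScaleInference.

Theorem proposition5 (R : realType) (T : inverse_assignment R)
    (hT : obeys_inverse_rules T)
    (Phi phi : R -> R) (I : parametric_family R R (R * R))
    (hI : is_location_scale Phi phi I)
    (zeta1 zeta2 zeta : R * R -> R)
    (h1 : cfactor_given2 T I zeta1)
    (h2 : cfactor_given1 T I zeta2)
    (h : cfactor_joint T I zeta) :
  [/\ eq_up_to_given2 (params I) zeta1 (fun=> 1),
      eq_up_to_given1 (params I) zeta2 (fun theta => theta.2^-1) &
      eq_up_to_constant (params I) zeta (fun theta => theta.2^-1)].
Proof.
split.
- exact: (cfactor_given2_location hT hI h1).
- exists (fun m => zeta2 (m, 1)) => -[m s]; rewrite (location_scale_params hI) /= => s0.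
  exact: (cfactor_given1_scale hT hI h2).
- exists (zeta (0, 1)) => -[m s]; rewrite (location_scale_params hI) /= => s0; split.
    by apply: (consistency_factor_neq0 h); rewrite /= (location_scale_params hI) /= ltr01.
  have [zE _] := cfactor_joint_affine hT hI h.
  by rewrite zE//=; exact: (cfactor_joint_scale hT hI h2 h).
Qed.
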